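(* Let $\mathcal M_{(3,3)}$ be the class of smooth complete Riemannian manifolds satisfying the $(3,3)$-bipolar comparison, and let $\mathcal M_{\ge 0}$ be the class of complete Riemannian manifolds with nonnegative sectional curvature. Then $\mathcal M_{(3,3)}\neq \mathcal M_{\ge 0}$.
   Context: Riemannian manifolds are smooth and connected, and are regarded as metric spaces with the Riemannian distance; $|x-y|_X$ denotes the distance between points $x,y$ of a metric space $X$. Let $\mathbb{H}$ be the (infinite-dimensional) Hilbert space. A metric space $X$ satisfies the $(k,l)$-bipolar comparison if for any points $a_0,a_1,\dots,a_k,b_0,b_1,\dots,b_l\in X$ there are points $\hat a_0,\hat a_1,\dots,\hat a_k,\hat b_0,\hat b_1,\dots,\hat b_l\in\mathbb{H}$ such that $$|\hat a_0-\hat b_0|_{\mathbb{H}}=|a_0-b_0|_X,\quad |\hat a_i-\hat a_0|_{\mathbb{H}}=|a_i-a_0|_X,\quad |\hat b_j-\hat b_0|_{\mathbb{H}}=|b_j-b_0|_X$$ for all $1\le i\le k$, $1\le j\le l$, and $$|\hat x-\hat y|_{\mathbb{H}}\ge |x-y|_X$$ for any $x,y\in\{a_0,\dots,a_k,b_0,\dots,b_l\}$, where $\hat x,\hat y$ are the points of $\mathbb{H}$ corresponding to $x,y$. *)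

(* Defs.v *)
From HB Require Import structures.
From mathcomp Require Import all_boot all_order all_algebra.
From mathcomp Require Import all_classical all_reals all_analysis.

Set Implicit Arguments.
Unset Strict Implicit.
Unset Printing Implicit Defensive.
Import Order.TTheory GRing.Theory Num.Theory.
Import numFieldNormedType.Exports.

Local Open Scope classical_set_scope.
Local Open Scope ring_scope.

Record hilbert (R : realType) := Hilbert {
  hilbert_seq :> nat -> R ;
  hilbert_summable : cvgn (series (fun i => hilbert_seq i ^+ 2)) }.

Definition hilbert_dist (R : realType) (x y : hilbert R) : R :=
  Num.sqrt (limn (series (fun i => (x i - y i) ^+ 2))).

(* The points are a_0, ..., a_k and b_0, ..., b_l, hence k + 1 and l + 1 of
   them. The lower bounds range over labels, so that two labels may carry the
   same point of X and still have distinct images. *)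
Definition bipolar_comparison (R : realType) (k l : nat) (X : Type)
    (d : X -> X -> R) : Prop :=
  forall (a : 'I_k.+1 -> X) (b : 'I_l.+1 -> X),
  exists (a' : 'I_k.+1 -> hilbert R) (b' : 'I_l.+1 -> hilbert R),
    let pt (s : 'I_k.+1 + 'I_l.+1) :=
      match s with inl i => a i | inr j => b j end in
    let pt' (s : 'I_k.+1 + 'I_l.+1) :=
      match s with inl i => a' i | inr j => b' j end in
    [/\ hilbert_dist (a' ord0) (b' ord0) = d (a ord0) (b ord0),
        forall i, i != ord0 -> hilbert_dist (a' i) (a' ord0) = d (a i) (a ord0),
        forall j, j != ord0 -> hilbert_dist (b' j) (b' ord0) = d (b j) (b ord0) &
        forall s t, d (pt s) (pt t) <= hilbert_dist (pt' s) (pt' t)].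

Definition complete_dist (R : realType) (X : Type) (d : X -> X -> R) : Prop :=
  forall u : nat -> X,
    (forall e : R, 0 < e ->
       exists N, forall m n, (N <= m)%N -> (N <= n)%N -> d (u m) (u n) < e) ->
    exists p : X, d (u n) p @[n --> \oo] --> (0 : R).

Fixpoint Ck_on (R : realType) (V W : normedModType R) (k : nat) (U : set V)
    (f : V -> W) : Prop :=
  (forall x, U x -> {for x, continuous f}) /\
  match k with
  | 0 => True
  | k'.+1 => forall v, (forall x, U x -> derivable f x v) /\
                       Ck_on k' U ('D_v f)
  end.

(* Only meant for open U. *)
Definition smooth_on (R : realType) (V W : normedModType R) (U : set V)
    (f : V -> W) : Prop := forall k, Ck_on k U f.

Record chart (R : realType) (M : topologicalType) (n : nat) := Chart {
  chart_dom : set M ;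
  chart_map :> M -> 'rV[R]_n ;
  chart_inv : 'rV[R]_n -> M ;
  chart_dom_open : open chart_dom ;
  chart_img_open : open (chart_map @` chart_dom) ;
  chart_mapK : forall p, chart_dom p -> chart_inv (chart_map p) = p ;
  chart_map_continuous :
    forall p, chart_dom p -> {for p, continuous chart_map} ;
  chart_inv_continuous :
    forall x, (chart_map @` chart_dom) x -> {for x, continuous chart_inv} }.

Definition chart_img (R : realType) (M : topologicalType) (n : nat)
  (c : chart R M n) : set 'rV[R]_n := c @` chart_dom c.

Definition overlap (R : realType) (M : topologicalType) (n : nat)
  (c c' : chart R M n) : set 'rV[R]_n := c @` (chart_dom c `&` chart_dom c').

Definition transition (R : realType) (M : topologicalType) (n : nat)
  (c c' : chart R M n) : 'rV[R]_n -> 'rV[R]_n := c' \o chart_inv c.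

(* Connected smooth manifolds without boundary, of any finite dimension. *)
Record smooth_manifold (R : realType) := SmoothManifold {
  carrier :> topologicalType ;
  dim : nat ;
  chart_index : Type ;
  atlas : chart_index -> chart R carrier dim ;
  chart_at : carrier -> chart_index ;
  chart_atP : forall p, chart_dom (atlas (chart_at p)) p ;
  transition_smooth : forall i j,
    smooth_on (overlap (atlas i) (atlas j)) (transition (atlas i) (atlas j)) ;
  manifold_hausdorff : hausdorff_space carrier ;
  manifold_second_countable : @second_countable carrier ;
  manifold_nonempty : [set: carrier] !=set0 ;
  manifold_connected : connected [set: carrier] }.

Definition inner (R : realType) (n : nat) (G : 'M[R]_n) (u v : 'rV[R]_n) : R :=
  (u *m G *m v^T) 0 0.

(* gram i x is the matrix of the metric in the i-th chart, at the point of
   coordinates x; its values outside the image of the chart are irrelevant.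
   Jacobians act on row vectors, hence the shape of gram_transition. *)
Record riemannian_manifold (R : realType) := RiemannianManifold {
  base :> smooth_manifold R ;
  gram : chart_index base -> 'rV[R]_(dim base) -> 'M[R]_(dim base) ;
  gram_smooth : forall i, smooth_on (chart_img (atlas i)) (gram i) ;
  gram_sym : forall i x, chart_img (atlas i) x -> (gram i x)^T = gram i x ;
  gram_posdef : forall i x, chart_img (atlas i) x ->
    forall v, v != 0 -> 0 < inner (gram i x) v v ;
  gram_transition : forall i j x, overlap (atlas i) (atlas j) x ->
    let f := transition (atlas i) (atlas j) in
    gram i x = 'J f x *m gram j (f x) *m ('J f x)^T }.

Definition smooth_curve (R : realType) (M : smooth_manifold R) (c : R -> M) :
    Prop :=
  continuous c /\
  forall i, smooth_on (c @^-1` chart_dom (atlas i)) (atlas i \o c).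

Definition speed (R : realType) (M : riemannian_manifold R) (c : R -> M)
    (t : R) : R :=
  let i := chart_at (c t) in
  let v := derive1 (atlas i \o c) t in
  Num.sqrt (inner (gram i (atlas i (c t))) v v).

Definition curve_length (R : realType) (M : riemannian_manifold R)
    (c : R -> M) : R :=
  (\int[lebesgue_measure]_(t in `[0%R, 1%R]) speed c t)%R.

(* piecewise_smooth_path p q L: some piecewise smooth path from p to q has
   length L. Each smooth piece is the restriction to [0, 1] of a smooth curve
   on the whole line. *)
Inductive piecewise_smooth_path (R : realType) (M : riemannian_manifold R) :
    M -> M -> R -> Prop :=
| path_nil p : piecewise_smooth_path p p 0
| path_cons (c : R -> M) q L :
    smooth_curve c -> piecewise_smooth_path (c 1) q L ->
    piecewise_smooth_path (c 0) q (curve_length c + L).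

Definition riem_dist (R : realType) (M : riemannian_manifold R) (p q : M) : R :=
  inf [set L | piecewise_smooth_path p q L].

Definition partial (R : realType) (n : nat) (i : 'I_n) (f : 'rV[R]_n -> R) :
  'rV[R]_n -> R := 'D_(delta_mx 0 i) f.

(* Gamma^k_ij *)
Definition christoffel (R : realType) (n : nat) (G : 'rV[R]_n -> 'M[R]_n)
    (k i j : 'I_n) (x : 'rV[R]_n) : R :=
  2^-1 * \sum_(l < n) invmx (G x) k l *
    (partial i (fun y => G y j l) x + partial j (fun y => G y i l) x
     - partial l (fun y => G y i j) x).

(* The coefficient along d_l of R(d_i, d_j) d_k, with the sign convention
   R(X, Y) Z = nabla_X nabla_Y Z - nabla_Y nabla_X Z - nabla_[X,Y] Z. *)
Definition riemann_coef (R : realType) (n : nat) (G : 'rV[R]_n -> 'M[R]_n)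
    (l k i j : 'I_n) (x : 'rV[R]_n) : R :=
  partial i (christoffel G l j k) x - partial j (christoffel G l i k) x
  + \sum_(m < n) (christoffel G l i m x * christoffel G m j k x
                  - christoffel G l j m x * christoffel G m i k x).

Definition curvature (R : realType) (n : nat) (G : 'rV[R]_n -> 'M[R]_n)
    (x u v w : 'rV[R]_n) : 'rV[R]_n :=
  \row_(l < n) \sum_(i < n) \sum_(j < n) \sum_(k < n)
    u 0 i * v 0 j * w 0 k * riemann_coef G l k i j x.

Definition sectional_curvature (R : realType) (n : nat)
    (G : 'rV[R]_n -> 'M[R]_n) (x u v : 'rV[R]_n) : R :=
  inner (G x) (curvature G x u v v) u /
  (inner (G x) u u * inner (G x) v v - inner (G x) u v ^+ 2).

Definition nonneg_sectional_curvature (R : realType)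
    (M : riemannian_manifold R) : Prop :=
  forall (i : chart_index M) x, chart_img (atlas i) x ->
  forall u v, free [:: u; v] -> 0 <= sectional_curvature (gram i) x u v.

(* Classes of manifolds are predicates: riemannian_manifold R is too large to
   be the argument of set. *)
Definition riem_bipolar (R : realType) (k l : nat) :
    riemannian_manifold R -> Prop :=
  fun M => complete_dist (@riem_dist R M) /\
           bipolar_comparison k l (@riem_dist R M).

Definition riem_sec_ge0 (R : realType) : riemannian_manifold R -> Prop :=
  fun M => complete_dist (@riem_dist R M) /\ nonneg_sectional_curvature M.

(* Main.v *)
(** The counterexample is the Tzitzeica surface [xyz = 1] in the open octant:
    it is complete and of positive curvature, and at a large scale it looks
    like the corner [C] of a cube, that is three quadrants glued around a
    vertex of total angle 3 pi / 2.

    On [C] take points p and q on one face and two segments leaving p and q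
    that pass the vertex on its two sides, cross each other behind it, and end
    in x and y beyond the crossing.  Put c and d on these segments close to p
    and q, and prolong the segments backwards up to a and b.  All points but x
    and y lie on one flat face.  The tree with centres p and q and leaves
    x, a, c and y, b, d has only straight lines a-p-c-x and b-q-d-y, so in a
    Hilbert space the lower bounds for a, c against q and b, d against p make
    p, q, a, b, c, d rigid, and then x and y lie at the places prescribed by
    the planar development of the tree.  There they are at distance at most
    61 sqrt 2, whereas on [C] the vertex has pushed them 144 apart.  The
    contradiction is robust, hence survives on the smooth surface for the same
    configuration scaled by a large factor.

    Lengths are bounded above by explicit curves.  Distances are bounded below
    by functions that are 1-Lipschitz on each face of a corner [C'] which the
    surface leaves strictly on one side. *)
Require Import Defs.
From mathcomp Require Import all_boot all_order all_algebra.
From mathcomp Require Import all_classical all_reals all_analysis.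
From mathcomp Require Import ring lra.

Set Implicit Arguments.
Unset Strict Implicit.
Unset Printing Implicit Defensive.
Import Order.TTheory GRing.Theory Num.Theory.
Import numFieldNormedType.Exports.

Local Open Scope classical_set_scope.
Local Open Scope ring_scope.

(** * Quadratic inequalities for distances in Hilbert space *)

Lemma hilbert_dist_cvg (R : realType) (x y : hilbert R) :
  series (fun i => (x i - y i) ^+ 2) @ \oo --> hilbert_dist x y ^+ 2.
Proof.
have cv : cvgn (series (fun i => (x i - y i) ^+ 2)).
  have cv2 (z : hilbert R) : cvgn (series (fun i => 2 * z i ^+ 2)).
    have -> : series (fun i => 2 * z i ^+ 2) =
              2 *: (series (fun i => z i ^+ 2) : R^nat).
      by apply/funext => n; rewrite /series /= fctE -mulr_sumr.
    exact: is_cvgZr (@hilbert_summable R z).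
  apply: (@series_le_cvg R _ (fun i => 2 * x i ^+ 2 + 2 * y i ^+ 2)).
  - by move=> n; exact: sqr_ge0.
  - by move=> n; rewrite addr_ge0 // mulr_ge0 ?sqr_ge0.
  - by move=> n; have := sqr_ge0 (x n + y n); lra.
  - have -> : series (fun i => 2 * x i ^+ 2 + 2 * y i ^+ 2) =
        (series (fun i => 2 * x i ^+ 2) + series (fun i => 2 * y i ^+ 2) : R^nat).
      by apply/funext => n; rewrite /series /= fctE -big_split.
    exact: is_cvgD (cv2 x) (cv2 y).
rewrite sqr_sqrtr //.
apply: limr_ge => //; near=> n.
by rewrite /series /= sumr_ge0 // => i _; exact: sqr_ge0.
Unshelve. all: by end_near. Qed.

(** A weighted sum of squared distances is the sum over the coordinates of one quadratic form in
    real numbers, so its sign has to be checked on the line only. An entry of [s] is a weight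
    together with a pair of labels. *)
Lemma hilbert_stress (R : realType) (T : Type) (P : T -> hilbert R)
    (s : seq (R * (T * T))) :
  (forall f : T -> R,
    0 <= \sum_(e <- s) e.1 * (f e.2.1 - f e.2.2) ^+ 2) ->
  0 <= \sum_(e <- s) e.1 * hilbert_dist (P e.2.1) (P e.2.2) ^+ 2.
Proof.
move=> s_ge0.
pose u n := \sum_(e <- s)
  e.1 * series (fun i => (P e.2.1 i - P e.2.2 i) ^+ 2) n.
have cvu : u @ \oo -->
    \sum_(e <- s) e.1 * hilbert_dist (P e.2.1) (P e.2.2) ^+ 2.
  rewrite /u; elim: s {s_ge0 u} => [|e s IH].
    by rewrite big_nil; under eq_fun do rewrite big_nil; exact: cvg_cst.
  rewrite big_cons; under eq_fun do rewrite big_cons.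
  apply: cvgD => //; apply: cvgMr; exact: hilbert_dist_cvg.
rewrite -(cvg_lim _ cvu) //; apply: limr_ge; first by apply/cvg_ex; eexists; exact: cvu.
near=> n; rewrite /u /series /=.
under eq_bigr do rewrite mulr_sumr.
rewrite exchange_big sumr_ge0 // => i _.
exact: (s_ge0 (fun t => P t i)).
Unshelve. all: by end_near. Qed.

(* [3p - 2a] and [3q - 2b] are the places that the planar development assigns
   to x and y; [2p - a] and [2q - b] are those of c and d.  The weight [m] pays for
   replacing c by [2p - a] in [|c - q|] and d by [2q - b] in [|a - d|]. *)
Lemma hilbert_double_star (R : realType) (m : R) (p x a c q y b d : hilbert R) :
  let N u v := hilbert_dist u v ^+ 2 in
  1 <= m ->
  N x y <= 2 * (17 * N p q + 14 * N a p + 14 * N b q - 2 * N a q - 6 * N b p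
      - 4 * (1 - m^-1) * (N c q + N a d)
      + 4 * (m - 1) * (2 * N c p + 2 * N a p - N c a)
      + 4 * (m - 1) * (2 * N d q + 2 * N b q - N d b))
    + 4 * (3 * N x p + 6 * N a p - 2 * N x a)
    + 4 * (3 * N y q + 6 * N b q - 2 * N y b).
Proof.
move=> N m1; have m_gt0 : 0 < m by exact: lt_le_trans ltr01 m1.
have m0 : m != 0 by rewrite gt_eqF.
have mV_ge0 : 0 <= m^-1 by rewrite invr_ge0 ltW.
pose P := nth p [:: p; x; a; c; q; y; b; d].
(* The weights of right side minus left side; the labels 0 to 7 stand for p, x, a, c, q, y, b, d. *)
pose s : seq (R * (nat * nat)) :=
  [:: (34, (0%N, 4%N)); (28 + 16 * (m - 1) + 24, (2%N, 0%N));
      (28 + 16 * (m - 1) + 24, (6%N, 4%N)); (-4, (2%N, 4%N)); (-12, (6%N, 0%N));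
      (-8 * (1 - m^-1), (3%N, 4%N)); (-8 * (1 - m^-1), (2%N, 7%N));
      (16 * (m - 1), (3%N, 0%N)); (-8 * (m - 1), (3%N, 2%N));
      (16 * (m - 1), (7%N, 4%N)); (-8 * (m - 1), (7%N, 6%N));
      (12, (1%N, 0%N)); (-8, (1%N, 2%N)); (12, (5%N, 4%N)); (-8, (5%N, 6%N));
      (-1, (1%N, 5%N))].
have := @hilbert_stress R nat P s; rewrite /s !big_cons !big_nil /P /=.
rewrite -!/(N _ _) => H; rewrite -subr_ge0.
apply: (le_trans (H _)); last by lra.
move=> f; rewrite !big_cons big_nil /=.
set fp := f 0%N; set fx := f 1%N; set fa := f 2%N; set fc := f 3%N.
set fq := f 4%N; set fy := f 5%N; set fb := f 6%N; set fd := f 7%N.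
(* On the line the combination of [N x p], [N a p], [N x a] is the square of [dx], and that of
   [N c p], [N a p], [N c a] is the square of [g]; likewise [dy] and [h]. As
   [fx - fy = S + dx - dy], the first two squares below equal
   [2 S^2 + 4 dx^2 + 4 dy^2 - (fx - fy)^2]. The two with [m^-1] complete the square when c, d are
   traded for 2p - a = c - g and 2q - b = d - h. *)
pose dx := fx - 3 * fp + 2 * fa; pose dy := fy - 3 * fq + 2 * fb.
pose S := 3 * fp - 2 * fa - 3 * fq + 2 * fb.
pose g := fc + fa - 2 * fp; pose h := fd + fb - 2 * fq.
have : 0 <= (S - dx + dy) ^+ 2 + 2 * (dx + dy) ^+ 2
    + 8 * m^-1 * (fc - fq - m * g) ^+ 2
    + 8 * m^-1 * (fa - fd + m * h) ^+ 2.
  by rewrite !addr_ge0 ?sqr_ge0 // mulr_ge0 ?sqr_ge0 // mulr_ge0.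
move/le_trans; apply; rewrite le_eqVlt; apply/orP; left; apply/eqP.
by rewrite /S /dx /dy /g /h; field.
Qed.

(** * Directional derivatives and closure properties of C^k maps *)

Lemma is_derive_comp1 (R : realType) (V : normedModType R) (f : V -> R)
    (g : R -> R) (x v : V) (df dg : R) :
  is_derive x v f df -> is_derive (f x) 1 g dg ->
  is_derive x v (g \o f) (dg * df).
Proof.
move=> [fx dfE] [gx dgE].
(* Restricting f to the line through x along v reduces the claim to the chain rule in one variable;
   derivability in this single direction is enough. *)
pose k := fun h : R => f (h *: v + x).
have k0 : k 0 = f x by rewrite /k scale0r add0r.
have kd : derivable k 0 1 by have /derivable1P := fx.
have kE : derive1 k 0 = df.
  rewrite -dfE derive1E /derive /k scale0r add0r.
  by under eq_fun do rewrite /= addr0 [_%:A]mulr1.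
have gk0 : derivable g (k 0) 1 := (eq_ind_r (fun y => derivable g y 1) gx k0).
have gk : derivable (g \o k) 0 1.
  apply/derivable1_diffP/differentiable_comp; apply/derivable1_diffP.
    exact: kd.
  exact: gk0.
have gkE : derive1 (g \o k) 0 = dg * df.
  by rewrite (derive1_comp kd gk0) kE k0 derive1E dgE.
have gfd : derivable (g \o f) x v by apply/derivable1P.
split=> //; rewrite -gkE derive1E /derive /k /= scale0r add0r.
by under [in RHS]eq_fun do rewrite /= addr0 [_%:A]mulr1.
Qed.

Lemma continuous_mx (R : realType) (T : topologicalType) (m n : nat)
    (F : T -> 'M[R]_(m, n)) (x : T) :
  (forall i j, {for x, continuous (fun y => F y i j)}) -> {for x, continuous F}.
Proof.
move=> Fc A [P FP PA].
have : \forall y \near x, forall i j, P i j (F y i j).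
  apply: filter_forall => i; apply: filter_forall => j.
  exact: (Fc i j) (FP i j).
by apply: filterS => y Py; exact: PA.
Qed.

Lemma Ck_onW (R : realType) (V W : normedModType R) k U (f : V -> W) :
  Ck_on k.+1 U f -> Ck_on k U f.
Proof.
elim: k f => [|k IH] f [fc fd]; first by split.
by split=> // v; have [fv dfv] := fd v; split=> //; exact: IH.
Qed.

Lemma Ck_cst (R : realType) (V W : normedModType R) k (c : W) :
  Ck_on k [set: V] (fun=> c).
Proof.
elim: k c => [|k IH] c; first by split=> // x _; exact: cvg_cst.
split=> [x _|v]; first exact: cvg_cst.
split=> [x _|]; first exact: derivable_cst.
rewrite (_ : 'D_v _ = fun=> 0); first exact: IH.
by apply/funext => x; exact: derive_cst.
Qed.

Lemma Ck_add (R : realType) (V W : normedModType R) k (f g : V -> W) :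
  Ck_on k setT f -> Ck_on k setT g -> Ck_on k setT (fun x => f x + g x).
Proof.
elim: k f g => [|k IH] f g [fc fd] [gc gd].
  by split=> // x _; apply: cvgD; [exact: fc|exact: gc].
split=> [x _|v]; first by apply: cvgD; [exact: fc|exact: gc].
have [fv dfk] := fd v; have [gv dgk] := gd v.
split=> [x _|]; first by apply: derivableD; [exact: fv|exact: gv].
rewrite (_ : 'D_v _ = fun x => 'D_v f x + 'D_v g x); first exact: IH.
by apply/funext => x; rewrite deriveD //; [exact: fv|exact: gv].
Qed.

Lemma Ck_mul (R : realType) (V : normedModType R) k (f g : V -> R) :
  Ck_on k setT f -> Ck_on k setT g -> Ck_on k setT (fun x => f x * g x).
Proof.
elim: k f g => [|k IH] f g [fc fd] [gc gd].
  by split=> // x _; apply: cvgM; [exact: fc|exact: gc].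
split=> [x _|v]; first by apply: cvgM; [exact: fc|exact: gc].
have [fv dfk] := fd v; have [gv dgk] := gd v.
split=> [x _|]; first by apply: derivableM; [exact: fv|exact: gv].
rewrite (_ : 'D_v _ = fun x => f x * 'D_v g x + g x * 'D_v f x).
  by apply: Ck_add; apply: IH => //; exact: Ck_onW.
by apply/funext => x; rewrite deriveM //; [exact: fv|exact: gv].
Qed.

Lemma Ck_expR (R : realType) (V : normedModType R) k (f : V -> R) :
  Ck_on k setT f -> Ck_on k setT (fun x => expR (f x)).
Proof.
elim: k f => [|k IH] f [fc fd].
  by split=> // x _; apply: continuous_comp (fc x I) _; exact: continuous_expR.
split=> [x _|v].
  by apply: continuous_comp (fc x I) _; exact: continuous_expR.
have [fv dfk] := fd v.
have D x : is_derive x v (expR \o f) (expR (f x) * 'D_v f x).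
  by apply: is_derive_comp1; exact/derivableP/fv.
split=> [x _|]; first by have [] := D x.
rewrite (_ : 'D_v _ = fun x => expR (f x) * 'D_v f x).
  by apply: Ck_mul => //; apply: IH; exact: Ck_onW.
by apply/funext => x; have [] := D x.
Qed.

Lemma Ck_inv (R : realType) (V : normedModType R) k (f : V -> R) :
  (forall x, 0 < f x) -> Ck_on k setT f -> Ck_on k setT (fun x => (f x)^-1).
Proof.
move=> f0; elim: k f f0 => [|k IH] f f0 [fc fd].
  by split=> // x _; apply: cvgV (fc x I); rewrite gt_eqF.
split=> [x _|v]; first by apply: cvgV (fc x I); rewrite gt_eqF.
have [fv dfk] := fd v.
have fn x : f x != 0 by rewrite gt_eqF.
split=> [x _|]; first by apply: derivableV => //; exact: fv.
rewrite (_ : 'D_v _ = fun x => (- (f x)^-1 * (f x)^-1) * 'D_v f x).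
  have Vk : Ck_on k setT (fun x => (f x)^-1) by apply: IH => //; exact: Ck_onW.
  apply: Ck_mul => //; apply: Ck_mul => //.
  rewrite (_ : (fun x => _) = (fun x => -1 * (f x)^-1)).
    by apply: Ck_mul => //; exact: Ck_cst.
  by apply/funext => x; rewrite mulN1r.
apply/funext => x; rewrite deriveV ?fn//; last exact: fv.
by rewrite /GRing.scale /= -exprVn expr2 !mulNr.
Qed.

Lemma Ck_ln (R : realType) (V : normedModType R) k (f : V -> R) :
  (forall x, 0 < f x) -> Ck_on k setT f -> Ck_on k setT (fun x => ln (f x)).
Proof.
move=> f0 fk.
have lc x : {for x, continuous (fun x => ln (f x))}.
  case: k fk => [|k] [fc _]; apply: continuous_comp (fc x I) _;
  exact: continuous_ln.
case: k fk => [|k] fk; first by split=> // x _; exact: lc.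
split=> [x _|v]; first exact: lc.
have [_ /(_ v) [fv dfk]] := fk.
have D x : is_derive x v (@ln R \o f) ((f x)^-1 * 'D_v f x).
  by apply: is_derive_comp1; [exact/derivableP/fv|exact: is_derive1_ln].
split=> [x _|]; first by have [] := D x.
rewrite (_ : 'D_v _ = fun x => (f x)^-1 * 'D_v f x).
  by apply: Ck_mul => //; apply: Ck_inv => //; exact: Ck_onW.
by apply/funext => x; have [] := D x.
Qed.

Lemma Ck_mx (R : realType) (V : normedModType R) (m n k : nat)
    (F : V -> 'M[R]_(m, n)) :
  (forall i j, Ck_on k setT (fun x => F x i j)) -> Ck_on k setT F.
Proof.
elim: k F => [|k IH] F Fk.
  by split=> // x _; apply: continuous_mx => i j; have [+ _] := Fk i j; apply.
split=> [x _|v].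
  by apply: continuous_mx => i j; have [+ _] := Fk i j; apply.
have Fv x : derivable F x v.
  by apply/derivable_mxP => i j; have [_ /(_ v) [+ _]] := Fk i j; apply.
split=> [x _|]; first exact: Fv.
apply: IH => i j; have [_ /(_ v) [_]] := Fk i j.
congr Ck_on; apply/funext => x.
by rewrite derive_mx // mxE.
Qed.

Lemma Ck_id (R : realType) (V : normedModType R) k : Ck_on k setT (@id V).
Proof.
case: k => [|k]; first by split=> // x _; exact: cvg_id.
split=> [x _|v]; first exact: cvg_id.
split=> [x _|]; first exact: derivable_id.
rewrite (_ : 'D_v _ = fun=> v); first exact: Ck_cst.
by apply/funext => x; exact: derive_id.
Qed.

Lemma Ck_coord (R : realType) (V : normedModType R) (m n k : nat)
    (F : V -> 'M[R]_(m, n)) i j :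
  Ck_on k setT F -> Ck_on k setT (fun x => F x i j).
Proof.
elim: k F => [|k IH] F [Fc Fd].
  split=> // x _.
  exact: (@continuous_comp _ _ _ F (fun M : 'M[R]_(m, n) => M i j) x (Fc x I)
    (@coord_continuous _ _ _ _ _ _)).
split=> [x _|v].
  exact: (@continuous_comp _ _ _ F (fun M : 'M[R]_(m, n) => M i j) x (Fc x I)
    (@coord_continuous _ _ _ _ _ _)).
have [Fv dFk] := Fd v.
split=> [x _|]; first by have /derivable_mxP/(_ i j) := Fv x I.
have := IH _ dFk; congr Ck_on; apply/funext => x.
by rewrite derive_mx ?mxE //; exact: Fv.
Qed.

(** * Euclidean space as a manifold with a single chart *)

Lemma second_countable_mx (R : realType) (m n : nat) :
  @second_countable 'M[R]_(m, n).
Proof.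
pose f (qk : 'M[rat]_(m, n) * nat) : set 'M[R]_(m, n) :=
  ball (map_mx ratr qk.1 : 'M[R]_(m, n)) (qk.2.+1%:R^-1 : R).
exists (range f).
  apply: (card_le_trans (card_image_le f setT)); exact: countableP.
split=> [_ [qk _ <-]|M A /nbhs_ballP [e /= e0 eA]]; first exact: ball_open.
have e20 : 0 < e / 2 by rewrite divr_gt0.
have [k] := ltr_add_invr e20; rewrite add0r => ke.
have k0 : 0 < k.+1%:R^-1 :> R by rewrite invr_gt0.
have /choice [q qP] : forall ij : 'I_m * 'I_n, exists r : rat,
    `|M ij.1 ij.2 - ratr r| < k.+1%:R^-1.
  move=> [i j] /=.
  have [r] : exists r : rat, ratr r \in `]M i j, M i j + k.+1%:R^-1[.
    by apply: rat_in_itvoo; rewrite ltrDl.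
  rewrite in_itv /= => /andP[Mr rM].
  by exists r; rewrite distrC ger0_norm ?subr_ge0 ?ltW // ltrBlDl.
pose Q := \matrix_(i, j) q (i, j).
exists (f (Q, k)).
  split; first by exists (Q, k).
  by split=> // i j; rewrite /= !mxE -ball_normE /= distrC; exact: (qP (i, j)).
move=> N [_ fN]; apply: eA; split=> // i j.
have := fN i j; have := qP (i, j); rewrite -!ball_normE /= !mxE /= => h1 h2.
have -> : M i j - N i j = (M i j - ratr (q (i, j))) + (ratr (q (i, j)) - N i j).
  by rewrite addrA subrK.
rewrite (le_lt_trans (ler_normD _ _)) // [e]splitr.
by apply: ltrD; apply: lt_trans ke.
Qed.

(** The lines through the origin are connected and share the point 0. *)
Lemma connected_normed (R : realType) (V : normedModType R) :
  connected [set: V].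
Proof.
have -> : [set: V] = \bigcup_(v in [set: V]) range (fun t : R => t *: v).
  by rewrite predeqE => v; split=> // _; exists v => //; exists 1; rewrite ?scale1r.
apply: bigcup_connected.
  by exists 0 => v _; exists 0; rewrite ?scale0r.
move=> v _; apply: connected_continuous_connected.
  apply/connected_intervalP => x y _ _ z _; exact: I.
by apply: continuous_subspaceT => t; apply: cvgZl; exact: cvg_id.
Qed.

Lemma open_id_image (T : topologicalType) : open (id @` [set: T]).
Proof. by rewrite image_id; exact: openT. Qed.

Definition id_chart (R : realType) (n : nat) : chart R 'rV[R]_n n :=
  @Chart R 'rV[R]_n n setT id id openT (open_id_image _)
    (fun _ _ => erefl) (fun _ _ => cvg_id) (fun _ _ => cvg_id).

Lemma id_chart_transition (R : realType) (n : nat) :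
  smooth_on (overlap (id_chart R n) (id_chart R n))
    (transition (id_chart R n) (id_chart R n)).
Proof.
by move=> k; rewrite /overlap /= setIT image_id; exact: Ck_id.
Qed.

Definition euclidean (R : realType) (n : nat) : smooth_manifold R :=
  @SmoothManifold R 'rV[R]_n n unit (fun=> id_chart R n) (fun=> tt)
    (fun _ => I) (fun _ _ => @id_chart_transition R n)
    (@norm_hausdorff _ _) (@second_countable_mx R 1 n)
    (ex_intro _ 0 I) (@connected_normed R _).

Lemma jacobian_id (R : realType) (n : nat) (x : 'rV[R]_n) : 'J id x = 1%:M.
Proof.
apply/row_matrixP => i; rewrite !rowE mulmx1 -deriveEjacobian ?derive_id //.
Qed.

Lemma single_chart_gram_transition (R : realType) (n : nat)
    (G : 'rV[R]_n -> 'M[R]_n) (i j : chart_index (euclidean R n)) x :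
  overlap (atlas i) (atlas j) x ->
  let f := transition (atlas i) (atlas j) in
  G x = 'J f x *m G (f x) *m ('J f x)^T.
Proof.
move=> _ f; rewrite (_ : f = id) // jacobian_id.
by rewrite mul1mx trmx1 mulmx1.
Qed.

(** * The surface and its metric *)

Lemma sum_ord2 (V : zmodType) (F : 'I_2 -> V) : \sum_(i < 2) F i = F 0 + F 1.
Proof. by rewrite big_ord_recl big_ord1; congr (_ + F _); exact/val_inj. Qed.

(* The surface [xyz = 1] is parametrized by (u, v) |-> (e^u, e^v, e^-(u+v)). *)
Definition cx (R : realType) (p : 'rV[R]_2) : R := expR (p 0 0).
Definition cy (R : realType) (p : 'rV[R]_2) : R := expR (p 0 1).
Definition cz (R : realType) (p : 'rV[R]_2) : R := expR (- (p 0 0 + p 0 1)).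

(** The metric induced from R^3: x and y contribute diag(x^2, y^2), and z contributes z^2 to every
    entry because dz = -z (du + dv). *)
Definition tz_gram (R : realType) (p : 'rV[R]_2) : 'M[R]_2 :=
  \matrix_(i, j) (expR (p 0 i) * expR (p 0 i) * (i == j)%:R + cz p * cz p).

Lemma tz_gram_sym (R : realType) (p : 'rV[R]_2) : (tz_gram p)^T = tz_gram p.
Proof.
apply/matrixP => i j; rewrite !mxE; case: (eqVneq i j) => [->//|_]; rewrite !mulr0 //.
Qed.

Lemma tz_inner (R : realType) (p u v : 'rV[R]_2) : inner (tz_gram p) u v =
  cx p * u 0 0 * (cx p * v 0 0) + cy p * u 0 1 * (cy p * v 0 1)
  + cz p * (u 0 0 + u 0 1) * (cz p * (v 0 0 + v 0 1)).
Proof.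
rewrite /inner mxE sum_ord2 !mxE !sum_ord2 !mxE /=.
rewrite /cx /cy; set a := expR _; set b := expR _; set c := cz p.
by move: (u 0 0) (u 0 1) (v 0 0) (v 0 1) a b c => u0 u1 v0 v1 a b c; ring.
Qed.

Lemma tz_gram_posdef (R : realType) (p v : 'rV[R]_2) :
  v != 0 -> 0 < inner (tz_gram p) v v.
Proof.
move=> v0; rewrite tz_inner lt_neqAle eq_sym -!expr2.
rewrite !addr_ge0 ?sqr_ge0 // andbT; apply: contra v0.
rewrite paddr_eq0 ?addr_ge0 ?sqr_ge0 // paddr_eq0 ?sqr_ge0 // !sqrf_eq0.
rewrite !mulf_eq0 !(gt_eqF (expR_gt0 _)) /= => /andP[/andP[/eqP v00 /eqP v01] _].
apply/eqP/rowP => i; rewrite mxE.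
by case: i => [[|[|]]] // hi; [rewrite -[RHS]v00|rewrite -[RHS]v01];
  congr (v _ _); exact/val_inj.
Qed.

Lemma Ck_entry (R : realType) (n k : nat) j :
  Ck_on k setT (fun p : 'rV[R]_n => p 0 j).
Proof. exact: Ck_coord (@Ck_id _ _ _). Qed.

Lemma tz_gram_smooth (R : realType) : smooth_on setT (@tz_gram R).
Proof.
move=> k; apply: Ck_mx => i j.
rewrite (_ : (fun p => _) = (fun p : 'rV[R]_2 =>
    expR (p 0 i) * expR (p 0 i) * (i == j)%:R
    + expR (-1 * (p 0 0 + p 0 1)) * expR (-1 * (p 0 0 + p 0 1)))); last first.
  by apply/funext => p; rewrite mxE /cz mulN1r.
have zk : Ck_on k setT (fun p : 'rV[R]_2 => expR (-1 * (p 0 0 + p 0 1))).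
  apply/Ck_expR/Ck_mul; first exact: Ck_cst.
  by apply: Ck_add; exact: Ck_entry.
have ik : Ck_on k setT (fun p : 'rV[R]_2 => expR (p 0 i)).
  exact/Ck_expR/Ck_entry.
apply: Ck_add; last exact: Ck_mul.
by apply: Ck_mul; [exact: Ck_mul|exact: Ck_cst].
Qed.

Lemma id_chart_img (R : realType) (n : nat) : chart_img (id_chart R n) = setT.
Proof. exact: image_id. Qed.

Definition tzitzeica (R : realType) : riemannian_manifold R :=
  @RiemannianManifold R (euclidean R 2) (fun=> @tz_gram R)
    (fun _ => eq_ind_r (fun U => smooth_on U _) (@tz_gram_smooth R)
       (@id_chart_img R 2))
    (fun _ p _ => tz_gram_sym p) (fun _ p _ v v0 => tz_gram_posdef p v0)
    (fun i j x => @single_chart_gram_transition R 2 _ i j x).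

(** * Christoffel symbols and curvature of the surface *)

Lemma ord2E (i : 'I_2) : i = 0 \/ i = 1.
Proof. by case: i => [[|[|]]] // hi; [left|right]; exact/val_inj. Qed.

Lemma is_derive_coord (R : realType) (n : nat) (x v : 'rV[R]_n) j :
  is_derive x v (fun y : 'rV[R]_n => y 0 j) (v 0 j).
Proof.
have d : derivable (@id 'rV[R]_n) x v by exact: derivable_id.
split; first by have /derivable_mxP/(_ 0 j) := d.
by have /matrixP/(_ 0 j) := derive_mx d; rewrite derive_id mxE => ->.
Qed.

Lemma is_derive_cx (R : realType) (x v : 'rV[R]_2) :
  is_derive x v (@cx R) (cx x * v 0 0).
Proof. by apply: is_derive_comp1; exact: is_derive_coord. Qed.

Lemma is_derive_cy (R : realType) (x v : 'rV[R]_2) :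
  is_derive x v (@cy R) (cy x * v 0 1).
Proof. by apply: is_derive_comp1; exact: is_derive_coord. Qed.

Lemma is_derive_cz (R : realType) (x v : 'rV[R]_2) :
  is_derive x v (@cz R) (cz x * - (v 0 0 + v 0 1)).
Proof.
apply: is_derive_comp1.
by apply: is_deriveN; apply: is_deriveD; exact: is_derive_coord.
Qed.

Lemma is_derive_mul (R : realType) (V : normedModType R) (f g : V -> R) x v df dg :
  is_derive x v f df -> is_derive x v g dg ->
  is_derive x v (fun y => f y * g y) (f x * dg + g x * df).
Proof. by move=> fd gd; exact: is_deriveM. Qed.

Lemma is_derive_add (R : realType) (V W : normedModType R) (f g : V -> W) x v df dg :
  is_derive x v f df -> is_derive x v g dg ->
  is_derive x v (fun y => f y + g y) (df + dg).
Proof. by move=> fd gd; exact: is_deriveD. Qed.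

Lemma is_derive_inv (R : realType) (V : normedModType R) (f : V -> R) x v df :
  f x != 0 -> is_derive x v f df ->
  is_derive x v (fun y => (f y)^-1) (- (f x) ^- 2 * df).
Proof.
move=> fx [fd <-]; split; first exact: derivableV.
exact: deriveV.
Qed.

Lemma partial_tz_gram (R : realType) (i j l : 'I_2) (x : 'rV[R]_2) :
  partial i (fun y => tz_gram y j l) x =
  2 * (expR (x 0 j) * expR (x 0 j) * ((i == j) && (j == l))%:R - cz x * cz x).
Proof.
have E m v : is_derive x v (fun y : 'rV[R]_2 => expR (y 0 m)) (expR (x 0 m) * v 0 m).
  by apply: is_derive_comp1; exact: is_derive_coord.
pose v : 'rV[R]_2 := delta_mx 0 i.
have D : is_derive x v (fun y => tz_gram y j l)
   (2 * (expR (x 0 j) * expR (x 0 j) * ((i == j) && (j == l))%:R - cz x * cz x)).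
  rewrite (_ : (fun y => _) = fun y : 'rV[R]_2 =>
      expR (y 0 j) * expR (y 0 j) * (j == l)%:R + cz y * cz y); last first.
    by apply/funext => y; rewrite mxE.
  have Z := is_derive_cz x v.
  have H := is_derive_add (is_derive_mul (is_derive_mul (E j v) (E j v))
    (is_derive_cst ((j == l)%:R : R) x v)) (is_derive_mul Z Z).
  apply: (is_derive_eq H) => {H}.
  have -> : v 0 0 + v 0 1 = 1.
    by rewrite !mxE /=; case: (ord2E i) => ->; rewrite /= ?addr0 ?add0r.
  rewrite mxE /= (eq_sym j i); case: (i == j); case: (j == l) => /=; ring.
by have [] := D.
Qed.

(* With [D] the determinant of the metric, [s_0 = (yz)^2 / D] and
   [s_1 = (xz)^2 / D], the Christoffel symbols are
   [Gamma^k_ij = delta_kij - (1 + delta_ij) s_k], and the curvature is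
   [3 (xyz)^2 / D^2]. *)
Definition tz_det (R : realType) (x : 'rV[R]_2) : R :=
  (cx x * cy x) ^+ 2 + (cx x * cz x) ^+ 2 + (cy x * cz x) ^+ 2.

Lemma tz_det_gt0 (R : realType) (x : 'rV[R]_2) : 0 < tz_det x.
Proof. by rewrite /tz_det !addr_gt0 // exprn_gt0 // mulr_gt0 // expR_gt0. Qed.

Definition tz_s (R : realType) (k : 'I_2) (x : 'rV[R]_2) : R :=
  (if k == 0 then cy x * cz x else cx x * cz x) ^+ 2 / tz_det x.

(** The adjugate divided by the determinant [tz_det]. *)
Lemma invmx_tz_gram (R : realType) (x : 'rV[R]_2) :
  invmx (tz_gram x) = \matrix_(i, j)
    (((if i == 0 then cy x else cx x) ^+ 2 * (i == j)%:R
      + (if i == j then 1 else -1) * cz x ^+ 2) / tz_det x).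
Proof.
set M := (X in _ = X).
have D0 := tz_det_gt0 x.
suff MG : M *m tz_gram x = 1%:M.
  have [_ Gu] := mulmx1_unit MG.
  by rewrite -[invmx _]mul1mx -MG -mulmxA mulmxV // mulmx1.
apply/matrixP => i j; rewrite !mxE sum_ord2 !mxE.
have -> : expR (x 0 0) = cx x by [].
have -> : expR (x 0 1) = cy x by [].
move: D0; rewrite /tz_det => /lt0r_neq0 D0.
by case: (ord2E i) => ->; case: (ord2E j) => ->; rewrite /=; field.
Qed.

Lemma tz_christoffel (R : realType) (k i j : 'I_2) (x : 'rV[R]_2) :
  christoffel (@tz_gram R) k i j x =
  ((k == i) && (i == j))%:R - (1 + (i == j)%:R) * tz_s k x.
Proof.
rewrite /christoffel sum_ord2 !partial_tz_gram invmx_tz_gram !mxE /tz_s.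
have /lt0r_neq0 := tz_det_gt0 x; rewrite /tz_det => D0.
by case: (ord2E k) => ->; case: (ord2E i) => ->; case: (ord2E j) => ->;
  rewrite -?[expR (x 0 0)]/(cx x) -?[expR (x 0 1)]/(cy x) /=; field.
Qed.

(** A logarithmic derivative: those of (yz)^2, (xz)^2, (xy)^2 are -2 v_0, -2 v_1, 2 (v_0 + v_1), and
    the share of (xy)^2 in D is 1 - s_0 - s_1. *)
Lemma is_derive_tz_s (R : realType) (k : 'I_2) (x v : 'rV[R]_2) :
  is_derive x v (@tz_s R k) (tz_s k x *
    ((if k == 0 then -4 else -2) * v 0 0 + (if k == 0 then -2 else -4) * v 0 1
     + (4 * tz_s 0 x + 2 * tz_s 1 x) * v 0 0
     + (2 * tz_s 0 x + 4 * tz_s 1 x) * v 0 1)).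
Proof.
have X := is_derive_cx x v; have Y := is_derive_cy x v.
have Z := is_derive_cz x v.
have D0 := lt0r_neq0 (tz_det_gt0 x).
have XY := is_derive_mul X Y; have XZ := is_derive_mul X Z.
have YZ := is_derive_mul Y Z.
have D := is_derive_inv (f := @tz_det R) D0 (is_derive_add (is_derive_add
  (is_derive_mul XY XY) (is_derive_mul XZ XZ)) (is_derive_mul YZ YZ)).
have s0E : @tz_s R 0 = fun y => cy y * cz y * (cy y * cz y) / tz_det y by [].
have s1E : @tz_s R 1 = fun y => cx y * cz y * (cx y * cz y) / tz_det y by [].
case: (ord2E k) => -> /=; rewrite s0E s1E /=.
  have H := is_derive_mul (is_derive_mul YZ YZ) D.
  apply: (is_derive_eq H) => {H}.
  by move: D0; rewrite /tz_det => D0; field.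
have H := is_derive_mul (is_derive_mul XZ XZ) D.
apply: (is_derive_eq H) => {H}.
by move: D0; rewrite /tz_det => D0; field.
Qed.

(** This is the shape of every curvature tensor in dimension two, the leading factor being the Gauss
    curvature. The sixteen cases are identities of rational functions in x, y, z. *)
Lemma tz_riemann_coef (R : realType) (l k i j : 'I_2) (x : 'rV[R]_2) :
  riemann_coef (@tz_gram R) l k i j x =
  3 * (cx x * cy x * cz x / tz_det x) ^+ 2 *
    (tz_gram x j k * (i == l)%:R - tz_gram x i k * (j == l)%:R).
Proof.
have chE a b c : christoffel (@tz_gram R) a b c = fun y =>
    ((a == b) && (b == c))%:R + -1 * (1 + (b == c)%:R) * tz_s a y.
  by apply/funext => y; rewrite tz_christoffel; ring.
have pE a b c d : partial a (christoffel (@tz_gram R) b c d) x =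
   - (1 + (c == d)%:R) * (tz_s b x * ((if b == 0 then -4 else -2) * (a == 0)%:R
      + (if b == 0 then -2 else -4) * (a == 1)%:R
     + (4 * tz_s 0 x + 2 * tz_s 1 x) * (a == 0)%:R
     + (2 * tz_s 0 x + 4 * tz_s 1 x) * (a == 1)%:R)).
  rewrite chE /partial; set w := delta_mx 0 a.
  have H := is_derive_add (is_derive_cst (((b == c) && (c == d))%:R : R) x w)
    (is_derive_mul (is_derive_cst (-1 * (1 + (c == d)%:R) : R) x w)
       (is_derive_tz_s b x w)).
  have [_ ->] := H.
  by rewrite !mxE /= ![_ == a]eq_sym mulr0; ring.
have s0E : tz_s 0 x = cy x * cz x * (cy x * cz x) / tz_det x by [].
have s1E : tz_s 1 x = cx x * cz x * (cx x * cz x) / tz_det x by [].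
have g00 : tz_gram x 0 0 = cx x * cx x + cz x * cz x by rewrite mxE /= mulr1.
have g11 : tz_gram x 1 1 = cy x * cy x + cz x * cz x by rewrite mxE /= mulr1.
have g01 : tz_gram x 0 1 = cz x * cz x by rewrite mxE /= mulr0 add0r.
have g10 : tz_gram x 1 0 = cz x * cz x by rewrite mxE /= mulr0 add0r.
have /lt0r_neq0 := tz_det_gt0 x; rewrite /tz_det in s0E s1E * => D0.
rewrite /riemann_coef sum_ord2 !pE !tz_christoffel.
by case: (ord2E i) => ->; case: (ord2E j) => ->; case: (ord2E k) => ->;
  case: (ord2E l) => ->; rewrite /= ?g00 ?g01 ?g10 ?g11 ?s0E ?s1E; field.
Qed.

Lemma inner_ord2 (R : realType) (G : 'M[R]_2) (a b : 'rV[R]_2) : inner G a b =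
  a 0 0 * b 0 0 * G 0 0 + a 0 0 * b 0 1 * G 0 1
  + a 0 1 * b 0 0 * G 1 0 + a 0 1 * b 0 1 * G 1 1.
Proof. by rewrite /inner mxE sum_ord2 !mxE !sum_ord2; ring. Qed.

Lemma tz_sectional_curvature_ge0 (R : realType) (x u v : 'rV[R]_2) :
  0 <= sectional_curvature (@tz_gram R) x u v.
Proof.
rewrite /sectional_curvature.
set K := 3 * (cx x * cy x * cz x / tz_det x) ^+ 2.
have K0 : 0 <= K by rewrite mulr_ge0 ?sqr_ge0.
have g01 : tz_gram x 1 0 = tz_gram x 0 1 by rewrite !mxE /= !mulr0.
have KE := tz_riemann_coef _ _ _ _ x; rewrite -/K in KE.
(* The sectional curvature is K times the Gram determinant over itself; that quotient is 1, or 0 by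
   the convention for division by zero. *)
have divdd_ge0 (d : R) : 0 <= d / d.
  by have [->|d0] := eqVneq d 0; rewrite ?mul0r ?divff.
have RE l : curvature (@tz_gram R) x u v v 0 l =
    K * (inner (tz_gram x) v v * u 0 l - inner (tz_gram x) u v * v 0 l).
  rewrite /curvature [LHS]mxE !sum_ord2 !KE !inner_ord2 g01.
  move: (tz_gram x) (K) => G K'.
  by case: (ord2E l) => ->; rewrite /=; ring.
have -> : inner (tz_gram x) (curvature (@tz_gram R) x u v v) u =
    K * (inner (tz_gram x) u u * inner (tz_gram x) v v
         - inner (tz_gram x) u v ^+ 2).
  rewrite [LHS]inner_ord2 !RE !inner_ord2 g01.
  by move: (tz_gram x) (K) => G K'; ring.
by rewrite -mulrA mulr_ge0.
Qed.

(** * Lengths of curves bounded below by Lipschitz functions *)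

Lemma is_derive_near (R : realType) (f : R -> R) (t l e : R) :
  is_derive t 1 f l -> 0 < e ->
  \forall s \near t, `|f s - f t - l * (s - t)| <= e * `|s - t|.
Proof.
move=> [fd fl] e0.
have : (fun h => h^-1 *: ((f \o shift t) (h *: 1) - f t)) @ 0^' --> l.
  by rewrite -fl; exact: fd.
move=> /cvgrPdist_le /(_ e e0); rewrite near_withinE => H.
have : \forall s \near t, s - t != 0 ->
    `|l - (s - t)^-1 *: (f ((s - t) *: 1 + t) - f t)| <= e.
  have tt : (s - t) @[s --> t] --> (0 : R).
    by rewrite -(subrr t); apply: cvgB; [exact: cvg_id|exact: cvg_cst].
  exact: (tt _ H).
apply: filterS => s.
have [->|st] := eqVneq s t; first by rewrite !subrr mulr0 subrr normr0 mulr0.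
rewrite subr_eq0 st => /(_ isT); rewrite /GRing.scale /= mulr1 subrK => H'.
have st0 : s - t != 0 by rewrite subr_eq0.
have -> : f s - f t - l * (s - t) =
    - ((l - (s - t)^-1 * (f s - f t)) * (s - t)) by field.
by rewrite normrN normrM ler_wpM2r.
Qed.

Lemma antiderivative (R : realType) (v : R -> R) : continuous v ->
  exists2 S : R -> R, (forall t : R, 0 <= t <= 1 -> is_derive t 1 S (v t)) &
    (\int[lebesgue_measure]_(t in `[0%R, 1%R]) v t)%R = S 1 - S 0.
Proof.
move=> vc.
have vi : lebesgue_measure.-integrable `[(-1 : R), 2] (EFin \o v).
  apply: continuous_compact_integrable; first exact: segment_compact.
  exact: continuous_subspaceT.
(* Integrating from -1 inside [-1, 2] makes 0 and 1 interior points, where the derivative is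
   two-sided. *)
pose S x := (\int[lebesgue_measure]_(t in `[(-1 : R), x]) v t)%R.
exists S => [t /andP[t0 t1]|].
  have t2 : t < 2 by lra.
  have t3 : (-1 : R) < t by lra.
  have [dS SE] := continuous_FTC1_closed t2 vi t3 (vc t).
  by split; [exact: dS|rewrite -derive1E SE].
have vi1 : lebesgue_measure.-integrable `[(-1 : R), 1] (EFin \o v).
  apply: integrableS vi => //; apply: subset_itvl; rewrite bnd_simp; lra.
rewrite /S (Rintegral_itvB vi1) ?bnd_simp//; try lra.
rewrite Rintegral_itv_obnd_cbnd //.
apply: integrableS vi1 => // x; rewrite /= !in_itv /=; lra.
Qed.

(** Continuous induction: let T be the supremum of the points where f is at most [f a]. Comparison
    to the left of T puts T into this set, and comparison to the right would go beyond T unless T =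
    b. *)
Lemma locally_nonincreasing (R : realType) (f : R -> R) (a b : R) :
  a <= b ->
  (forall t, a <= t <= b -> \forall s \near t,
     (s <= t -> f t <= f s) /\ (t <= s -> f s <= f t)) ->
  f b <= f a.
Proof.
move=> ab fnear.
pose E := [set t | a <= t <= b /\ f t <= f a].
have Ea : E a by split; rewrite ?lexx ?ab.
have Eb : has_ubound E by exists b => t [/andP[]].
have supE : has_sup E by split; [exists a|].
set T := sup E.
have aT : a <= T by exact: ub_le_sup.
have Tb : T <= b by apply: ge_sup; [exists a|move=> t [/andP[]]].
have fT : \forall s \near T, (s <= T -> f T <= f s) /\ (T <= s -> f s <= f T).
  by apply: fnear; rewrite aT.
have [e /= e0 eP] := (nbhs_ballP _ _).1 fT.
have [t Et Tt] := sup_adherent e0 supE.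
have tT : t <= T by exact: ub_le_sup.
have fTa : f T <= f a.
  apply: le_trans Et.2.
  have /eP[/(_ tT)] : ball T e t.
    by rewrite /ball /= ger0_norm ?subr_ge0 //; move: Tt; rewrite -/T; lra.
  by [].
have [TB|TB] := eqVneq T b; first by rewrite -TB.
have Tlt : T < b by rewrite lt_neqAle TB.
pose s := Num.min b (T + e / 2).
have Ts : T < s by rewrite lt_min Tlt ltrDl divr_gt0.
have se : s <= T + e / 2 by rewrite ge_min lexx orbT.
have sb : s <= b by rewrite ge_min lexx.
have /eP[_ /(_ (ltW Ts)) fsT] : ball T e s.
  by rewrite /ball /= ltr0_norm ?subr_lt0 //; lra.
have Es : E s by split; [rewrite sb andbT; lra|exact: le_trans fTa].
by have := ub_le_sup Eb Es; rewrite leNgt Ts.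
Qed.

Lemma tz_smooth_curveP (R : realType) (c : R -> tzitzeica R) :
  smooth_curve c <-> forall k, Ck_on k setT (c : R -> 'rV[R]_2).
Proof.
split=> [[_ /(_ tt)]|ck]; first by rewrite preimage_setT.
split=> [t|i k]; first by have [+ _] := ck 0%N; apply.
by rewrite preimage_setT; exact: ck.
Qed.

Definition tz_velocity (R : realType) (c : R -> 'rV[R]_2) (t : R) : R * R * R :=
  let v := 'D_1 c t in
  (cx (c t) * v 0 0, cy (c t) * v 0 1, cz (c t) * - (v 0 0 + v 0 1)).

Lemma is_derive_comp_rV (R : realType) (n : nat) (c : R -> 'rV[R]_n) t j :
  derivable c t 1 -> is_derive t 1 (fun s => c s 0 j) ('D_1 c t 0 j).
Proof.
move=> d; split; first by have /derivable_mxP/(_ 0 j) := d.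
by have /matrixP/(_ 0 j) := derive_mx d; rewrite mxE => ->.
Qed.

Lemma tz_velocityP (R : realType) (c : R -> 'rV[R]_2) (t : R) :
  derivable c t 1 ->
  let v := tz_velocity c t in
  [/\ is_derive t 1 (@cx R \o c) v.1.1, is_derive t 1 (@cy R \o c) v.1.2 &
      is_derive t 1 (@cz R \o c) v.2].
Proof.
move=> d.
have d0 := is_derive_comp_rV 0 d; have d1 := is_derive_comp_rV 1 d.
by split; apply: (@is_derive_comp1 _ _ _ expR).
Qed.

Lemma tz_velocity_continuous (R : realType) (c : R -> 'rV[R]_2) :
  Ck_on 1 setT c ->
  [/\ continuous (fun t => (tz_velocity c t).1.1),
      continuous (fun t => (tz_velocity c t).1.2) &
      continuous (fun t => (tz_velocity c t).2)].
Proof.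
move=> ck; have [_ /(_ 1) [_ dk]] := ck.
have c0 := Ck_onW ck.
have k j : Ck_on 0 setT (fun t => c t 0 j) by exact: Ck_coord.
have dkj j : Ck_on 0 setT (fun t => 'D_1 c t 0 j) by exact: Ck_coord.
have N f : Ck_on 0 setT f -> Ck_on 0 setT (fun t : R => - f t : R).
  move=> fk; rewrite (_ : (fun t => _) = fun t => -1 * f t).
    by apply: Ck_mul => //; exact: Ck_cst.
  by apply/funext => t; rewrite mulN1r.
split; [suff [+ _] : Ck_on 0 setT (fun t => (tz_velocity c t).1.1) |
  suff [+ _] : Ck_on 0 setT (fun t => (tz_velocity c t).1.2) |
  suff [+ _] : Ck_on 0 setT (fun t => (tz_velocity c t).2)];
  try (by move=> h t; exact: h); apply: Ck_mul => //; try exact: Ck_expR.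
- by apply: Ck_expR; apply: N; exact: Ck_add.
- by apply: N; exact: Ck_add.
Qed.

Lemma tz_speedE (R : realType) (c : R -> tzitzeica R) t :
  speed c t = let v := tz_velocity c t in
    Num.sqrt (v.1.1 ^+ 2 + v.1.2 ^+ 2 + v.2 ^+ 2).
Proof.
rewrite /speed derive1E tz_inner /tz_velocity /=; congr Num.sqrt.
by rewrite mulrN sqrrN !expr2.
Qed.

Lemma tz_speed_continuous (R : realType) (c : R -> tzitzeica R) :
  smooth_curve c -> continuous (speed c).
Proof.
move=> /tz_smooth_curveP/(_ 1%N)/tz_velocity_continuous[h1 h2 h3] t.
rewrite (_ : speed c = fun t => Num.sqrt ((tz_velocity c t).1.1 ^+ 2 +
  (tz_velocity c t).1.2 ^+ 2 + (tz_velocity c t).2 ^+ 2)); last first.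
  by apply/funext => s; rewrite tz_speedE.
apply: continuous_comp; last exact: sqrt_continuous.
apply: cvgD; first apply: cvgD.
- exact: cvgM (h1 t) (h1 t).
- exact: cvgM (h2 t) (h2 t).
- exact: cvgM (h3 t) (h3 t).
Qed.

Definition tz_chord (R : realType) (p q : 'rV[R]_2) : R :=
  Num.sqrt ((cx q - cx p) ^+ 2 + (cy q - cy p) ^+ 2 + (cz q - cz p) ^+ 2).

(** With k the increment of time, this bounds a short chord by the speed; the errors in the three
    coordinates add up to at most 3e. *)
Lemma sqrt_near_le (R : realType) (e k a b c x y z : R) : 0 <= e ->
  `|x - a * k| <= e * `|k| -> `|y - b * k| <= e * `|k| ->
  `|z - c * k| <= e * `|k| ->
  Num.sqrt (x ^+ 2 + y ^+ 2 + z ^+ 2) <=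
  (Num.sqrt (a ^+ 2 + b ^+ 2 + c ^+ 2) + 3 * e) * `|k|.
Proof.
move=> e0 xe ye ze.
set v := Num.sqrt (a ^+ 2 + b ^+ 2 + c ^+ 2).
have v0 : 0 <= v by exact: sqrtr_ge0.
have vE : v ^+ 2 = a ^+ 2 + b ^+ 2 + c ^+ 2.
  by rewrite sqr_sqrtr // !addr_ge0 ?sqr_ge0.
have coord_le d : d ^+ 2 <= v ^+ 2 -> `|d| <= v.
  by move=> dv; rewrite -(ger0_norm v0) -ler_sqr ?nnegrE // !real_normK ?num_real.
have av : `|a| <= v by apply: coord_le; rewrite vE -addrA lerDl addr_ge0 ?sqr_ge0.
have bv : `|b| <= v by apply: coord_le; rewrite vE addrAC lerDr addr_ge0 ?sqr_ge0.
have cv : `|c| <= v by apply: coord_le; rewrite vE lerDr addr_ge0 ?sqr_ge0.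
have sq_le (d w : R) : `|w - d * k| <= e * `|k| -> `|d| <= v ->
    w ^+ 2 <= (d * k) ^+ 2 + 2 * (v * `|k|) * (e * `|k|) + (e * `|k|) ^+ 2.
  move=> we dv; have -> : w = d * k + (w - d * k) by rewrite addrC subrK.
  move: we; set r := w - d * k => re.
  have h1 : d * k * r <= v * `|k| * (e * `|k|).
    rewrite (le_trans (ler_norm _)) // !normrM ler_pM ?mulr_ge0 //.
    by rewrite ler_wpM2r.
  have h2 : r ^+ 2 <= (e * `|k|) ^+ 2.
    by rewrite -(real_normK (num_real r)) ler_sqr ?nnegrE // mulr_ge0.
  move: (v * `|k|) (e * `|k|) (d * k) h1 h2 => A B D h1 h2; lra.
rewrite -[leRHS]ger0_norm ?mulr_ge0 ?addr_ge0 ?mulr_ge0 // -sqrtr_sqr ler_wsqrtr //.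
have := lerD (lerD (sq_le _ _ xe av) (sq_le _ _ ye bv)) (sq_le _ _ ze cv).
move/le_trans; apply.
have kE : `|k| ^+ 2 = k ^+ 2 by rewrite real_normK ?num_real.
have := sqr_ge0 (e * `|k|).
have -> : ((v + 3 * e) * `|k|) ^+ 2 =
  v ^+ 2 * `|k| ^+ 2 + 6 * (v * `|k|) * (e * `|k|) + 9 * (e * `|k|) ^+ 2 by ring.
rewrite vE kE !exprMn; lra.
Qed.

(** F may fail to be differentiable along c, so [- F - S - e t], with S an antiderivative of the
    speed, is shown to be locally nonincreasing. Of the slack e, three quarters pay for the chord
    and one quarter for S. *)
Lemma curve_length_ge (R : realType) (F : 'rV[R]_2 -> R) (c : R -> tzitzeica R) :
  (forall p, \forall q \near p, `|F q - F p| <= tz_chord p q) ->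
  smooth_curve c -> F (c 0) - F (c 1) <= curve_length c.
Proof.
move=> FL cs.
have [S dS SE] := antiderivative (tz_speed_continuous cs).
rewrite /curve_length SE; apply/ler_addgt0Pr => e e0.
have e40 : 0 < e / 4 by rewrite divr_gt0.
pose f t := - F (c t) - S t - e * t.
suff : f 1 <= f 0 by rewrite /f; lra.
apply: locally_nonincreasing => // t t01.
have [_ /(_ 1) [/(_ t I) cd _]] := (tz_smooth_curveP c).1 cs 1%N.
have [dx dy dz] := tz_velocityP cd.
have [/(_ t) cc _] := cs.
near=> s.
have Sn : `|S s - S t - speed c t * (s - t)| <= e / 4 * `|s - t|.
  by near: s; exact: is_derive_near (dS t t01) e40.
have Fn : `|F (c s) - F (c t)| <= (speed c t + 3 * (e / 4)) * `|s - t|.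
  have : `|F (c s) - F (c t)| <= tz_chord (c t) (c s) by near: s; exact: cc (FL _).
  move/le_trans; apply; rewrite tz_speedE; apply: sqrt_near_le (ltW e40) _ _ _.
  - by near: s; exact: is_derive_near dx e40.
  - by near: s; exact: is_derive_near dy e40.
  - by near: s; exact: is_derive_near dz e40.
move: Sn Fn; rewrite !ler_norml /f => /andP[S1 S2] /andP[F1 F2].
split=> [st|ts].
  by move: S1 S2 F1 F2; rewrite ler0_norm ?subr_le0 //; lra.
by move: S1 S2 F1 F2; rewrite ger0_norm ?subr_ge0 //; lra.
Unshelve. all: by end_near. Qed.

Lemma path_length_ge (R : realType) (F : 'rV[R]_2 -> R) (p q : tzitzeica R) L :
  (forall p, \forall q \near p, `|F q - F p| <= tz_chord p q) ->
  piecewise_smooth_path p q L -> F p - F q <= L.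
Proof.
move=> FL; elim=> [r|c r {}L cs _ IH]; first by rewrite subrr.
have -> : F (c 0) - F r = (F (c 0) - F (c 1)) + (F (c 1) - F r).
  by rewrite addrA subrK.
by apply: lerD; first exact: curve_length_ge.
Qed.

(** * Upper bounds on distances from explicit curves *)

Definition reach (R : realType) (M : riemannian_manifold R) (p q : M) (r : R) :=
  exists2 L, piecewise_smooth_path p q L & L <= r.

Lemma reach_trans (R : realType) (M : riemannian_manifold R) (p q s : M) (r r' : R) :
  reach p q r -> reach q s r' -> reach p s (r + r').
Proof.
move=> [L pq Lr] [L' qs Lr']; exists (L + L'); last exact: lerD.
elim: pq qs {Lr Lr'} => [x|c x l sc _ IH] xs; first by rewrite add0r.
by rewrite -addrA; apply: path_cons => //; exact: IH.
Qed.

Lemma reach_curve (R : realType) (M : riemannian_manifold R) (c : R -> M) (r : R) :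
  smooth_curve c -> curve_length c <= r -> reach (c 0) (c 1) r.
Proof.
move=> cs cr; exists (curve_length c + 0); last by rewrite addr0.
by apply: path_cons => //; exact: path_nil.
Qed.

Lemma curve_length_le (R : realType) (c : R -> tzitzeica R) (H h : R -> R) :
  smooth_curve c ->
  (forall t : R, 0 <= t <= 1 -> is_derive t 1 H (h t)) ->
  (forall t : R, 0 <= t <= 1 -> speed c t <= h t) ->
  curve_length c <= H 1 - H 0.
Proof.
move=> cs dH sh; have [S dS SE] := antiderivative (tz_speed_continuous cs).
rewrite /curve_length SE; apply/ler_addgt0Pr => e e0.
have e20 : 0 < e / 2 by rewrite divr_gt0.
pose f t := S t - H t - e * t.
suff : f 1 <= f 0 by rewrite /f; lra.
apply: locally_nonincreasing => // t t01.
have st := sh t t01.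
near=> s.
have Sn : `|S s - S t - speed c t * (s - t)| <= e / 2 * `|s - t|.
  by near: s; exact: is_derive_near (dS t t01) e20.
have Hn : `|H s - H t - h t * (s - t)| <= e / 2 * `|s - t|.
  by near: s; exact: is_derive_near (dH t t01) e20.
move: Sn Hn; rewrite !ler_norml /f => /andP[S1 S2] /andP[F1 F2].
split=> ts.
  have : 0 <= (h t - speed c t) * (t - s) by rewrite mulr_ge0 ?subr_ge0.
  by move: S1 S2 F1 F2; rewrite ler0_norm ?subr_le0 //; lra.
have : 0 <= (h t - speed c t) * (s - t) by rewrite mulr_ge0 ?subr_ge0.
by move: S1 S2 F1 F2; rewrite ger0_norm ?subr_ge0 //; lra.
Unshelve. all: by end_near. Qed.

Lemma sqrt_sum_le (R : realType) (a b : R) :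
  0 <= a -> Num.sqrt (a + b ^+ 2) <= Num.sqrt a + `|b|.
Proof.
move=> a0; have s0 := sqrtr_ge0 a.
rewrite -[leRHS]ger0_norm ?addr_ge0 // -sqrtr_sqr ler_wsqrtr //.
rewrite sqrrD sqr_sqrtr // real_normK ?num_real // addrAC lerDl.
by rewrite pmulrn_lge0 // mulr_ge0.
Qed.

(** Along a straight segment in the parameters (u, v) each of x, y, z is the exponential of an
    affine function, hence monotone. The speed is at most |x'| + |y'| + |z'|, and each term
    integrates to the total change of its coordinate. *)
Lemma tz_reach_taxicab (R : realType) (p q : tzitzeica R) :
  reach p q (`|cx q - cx p| + `|cy q - cy p| + `|cz q - cz p|).
Proof.
pose w : 'rV[R]_2 := (q : 'rV[R]_2) - p.
pose c t : tzitzeica R := (t *: w + p : 'rV[R]_2).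
have ck k : Ck_on k setT (c : R -> 'rV[R]_2).
  apply: Ck_add; last exact: Ck_cst.
  apply: Ck_mx => i j.
  rewrite (_ : (fun x => _) = fun x : R => x * w i j).
    by apply: Ck_mul; [exact: Ck_id|exact: Ck_cst].
  by apply/funext => t; rewrite mxE.
have cs : smooth_curve c by apply/tz_smooth_curveP.
have c0 : c 0 = p by rewrite /c scale0r add0r.
have c1 : c 1 = q by rewrite /c scale1r subrK.
rewrite -c0 -c1.
apply: reach_curve => //.
have cd (t : R) : derivable (c : R -> 'rV[R]_2) t 1.
  by have [_ /(_ 1) [+ _]] := ck 1%N; apply.
have dE t : 'D_1 c t = w.
  apply/matrixP => i j; rewrite derive_mx // mxE.
  rewrite (_ : (fun x => _) = fun x : R => x * w i j + p i j); last first.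
    by apply/funext => s; rewrite !mxE.
  have [_ ->] := is_derive_add (is_derive_mul (is_derive_id t (1 : R))
    (is_derive_cst (w i j) t 1)) (is_derive_cst (p i j) t 1).
  by rewrite mulr0 add0r mulr1 addr0.
pose sx := Num.sg (w 0 0); pose sy := Num.sg (w 0 1).
pose sz := Num.sg (- (w 0 0 + w 0 1)).
pose H t := sx * cx (c t) + sy * cy (c t) + sz * cz (c t).
pose h t := sx * (tz_velocity c t).1.1 + sy * (tz_velocity c t).1.2
  + sz * (tz_velocity c t).2.
have dH (t : R) : is_derive t 1 H (h t).
  have [dx dy dz] := tz_velocityP (cd t).
  have Z (s : R) (f : R -> R) (l : R) :
      is_derive t 1 f l -> is_derive t 1 (fun x => s * f x : R) (s * l).
    move=> fl; have H1 := is_derive_mul (is_derive_cst (s : R) t (1 : R)) fl.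
    by apply: (is_derive_eq H1); rewrite mulr0 addr0.
  exact: is_derive_add (is_derive_add (Z _ _ _ dx) (Z _ _ _ dy)) (Z _ _ _ dz).
apply: (le_trans (curve_length_le cs (fun t _ => dH t) _)).
  move=> t _; rewrite tz_speedE /h.
  have nE (e d : R) : 0 < e -> `|e * d| = Num.sg d * (e * d).
    by move=> e_gt0; rewrite normrM gtr0_norm // normrEsg mulrCA.
  apply: le_trans (sqrt_sum_le _ _) _; first by rewrite addr_ge0 ?sqr_ge0.
  apply: lerD.
    apply: le_trans (sqrt_sum_le _ _) _; first exact: sqr_ge0.
    by rewrite sqrtr_sqr /tz_velocity /= dE !nE ?expR_gt0.
  by rewrite /tz_velocity /= dE nE ?expR_gt0.
have sgle (s d : R) : Num.sg s * d <= `|d|.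
  rewrite (le_trans (ler_norm _)) // normrM normr_sg.
  by rewrite ler_piMl // lern1 leq_b1.
have -> : H 1 - H 0 = sx * (cx (c 1) - cx (c 0)) + sy * (cy (c 1) - cy (c 0))
  + sz * (cz (c 1) - cz (c 0)) by rewrite /H; ring.
by rewrite !lerD // sgle.
Qed.

(* A smooth reparametrization of [0, 1] whose values on the whole line stay in
   [0, 1], so that a segment traversed along it never leaves the octant. *)
Definition ease (R : realType) (t : R) : R :=
  2 * t * (1 + t * t)^-1 * (2 * t * (1 + t * t)^-1).

Definition ease' (R : realType) (t : R) : R :=
  8 * t * (1 - t * t) / (1 + t * t) ^+ 3.

Lemma ease_den_gt0 (R : realType) (t : R) : 0 < 1 + t * t.
Proof. by rewrite -expr2 ltr_pwDl // sqr_ge0. Qed.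

Lemma is_derive_ease (R : realType) (t : R) : is_derive t 1 (@ease R) (ease' t).
Proof.
have I1 := is_derive_id t (1 : R).
have D := is_derive_add (is_derive_cst (1 : R) t (1 : R)) (is_derive_mul I1 I1).
have n0 : 1 + t * t != 0 by rewrite gt_eqF // ease_den_gt0.
have V := is_derive_inv (f := fun s : R => 1 + s * s) n0 D.
have W := is_derive_mul (is_derive_mul (is_derive_cst (2 : R) t (1 : R)) I1) V.
have E := is_derive_mul W W.
by apply: (is_derive_eq E); rewrite /ease'; field.
Qed.

Lemma ease_itv (R : realType) (t : R) : 0 <= ease t <= 1.
Proof.
rewrite /ease -expr2 sqr_ge0 /= exprMn exprVn ler_pdivrMr ?exprn_gt0 ?ease_den_gt0 //.
by have := sqr_ge0 (1 - t * t); lra.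
Qed.

Lemma ease'_ge0 (R : realType) (t : R) : 0 <= t <= 1 -> 0 <= ease' t.
Proof.
move=> /andP[t0 t1]; rewrite /ease' divr_ge0 ?exprn_ge0 ?(ltW (ease_den_gt0 _)) //.
by rewrite !mulr_ge0 // subr_ge0 -expr2 expr_le1.
Qed.

Lemma Ck_ease (R : realType) k : Ck_on k setT (@ease R).
Proof.
have W : Ck_on k setT (fun t : R => 2 * t * (1 + t * t)^-1).
  apply: Ck_mul; first by apply: Ck_mul; [exact: Ck_cst|exact: Ck_id].
  apply: Ck_inv; first exact: ease_den_gt0.
  apply: Ck_add; first exact: Ck_cst.
  by apply: Ck_mul; exact: Ck_id.
exact: Ck_mul.
Qed.

Definition eased (R : realType) (a b t : R) : R := a + (b - a) * ease t.

Lemma eased_ge (R : realType) (m a b t : R) : m <= a -> m <= b -> m <= eased a b t.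
Proof.
move=> ma mb; rewrite /eased; have /andP[e0 e1] := ease_itv t.
have : 0 <= (a - m) * (1 - ease t) by rewrite mulr_ge0 ?subr_ge0.
have : 0 <= (b - m) * ease t by rewrite mulr_ge0 ?subr_ge0.
lra.
Qed.

Lemma is_derive_eased (R : realType) (a b t : R) :
  is_derive t 1 (eased a b) ((b - a) * ease' t).
Proof.
have E := is_derive_add (is_derive_cst a t (1 : R))
  (is_derive_mul (is_derive_cst (b - a) t (1 : R)) (is_derive_ease t)).
by apply: (is_derive_eq E); rewrite mulr0 addr0 add0r.
Qed.

Lemma Ck_eased (R : realType) (a b : R) k : Ck_on k setT (eased a b).
Proof.
apply: Ck_add; first exact: Ck_cst.
by apply: Ck_mul; [exact: Ck_cst|exact: Ck_ease].
Qed.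

Lemma eased0 (R : realType) (a b : R) : eased a b 0 = a.
Proof. by rewrite /eased /ease !mulr0 mul0r mulr0 mulr0 addr0. Qed.

Lemma eased1 (R : realType) (a b : R) : eased a b 1 = b.
Proof. by rewrite /eased /ease; field. Qed.

Lemma tz_speed_derive (R : realType) (c : R -> tzitzeica R) (t x' y' z' : R) :
  smooth_curve c -> is_derive t 1 (@cx R \o c) x' ->
  is_derive t 1 (@cy R \o c) y' -> is_derive t 1 (@cz R \o c) z' ->
  speed c t = Num.sqrt (x' ^+ 2 + y' ^+ 2 + z' ^+ 2).
Proof.
move=> /tz_smooth_curveP/(_ 1%N)[_ /(_ 1) [/(_ t I)/tz_velocityP[] dx dy dz _]].
move=> [_ <-] [_ <-] [_ <-]; rewrite tz_speedE.
by case: dx => _ ->; case: dy => _ ->; case: dz => _ ->.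
Qed.

(** The height over the face is 1/(ab), and for a, b >= 1 its derivative is at most |a'|/a^2 +
    |b'|/b^2 in absolute value. As a and b are monotone on [0, 1], each term integrates to at most
    1, whence the additive 2. The curve enters through its speed only, so that one lemma serves all
    three faces. *)
Lemma face_curve_length (R : realType) (c : R -> tzitzeica R) (a0 a1 b0 b1 : R) :
  smooth_curve c -> 1 <= a0 -> 1 <= a1 -> 1 <= b0 -> 1 <= b1 ->
  (forall t, speed c t = Num.sqrt (((a1 - a0) * ease' t) ^+ 2
     + ((b1 - b0) * ease' t) ^+ 2
     + (- ((eased a0 a1 t * eased b0 b1 t) ^- 2) *
        (eased a0 a1 t * ((b1 - b0) * ease' t)
         + eased b0 b1 t * ((a1 - a0) * ease' t))) ^+ 2)) ->
  curve_length c <= Num.sqrt ((a1 - a0) ^+ 2 + (b1 - b0) ^+ 2) + 2.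
Proof.
move=> cs a01 a11 b01 b11 sE.
set l := Num.sqrt _.
have a_ge1 t : 1 <= eased a0 a1 t by exact: eased_ge.
have b_ge1 t : 1 <= eased b0 b1 t by exact: eased_ge.
have neq0 (x : R) : 1 <= x -> x != 0.
  by move=> x1; rewrite gt_eqF // (lt_le_trans ltr01).
pose sa := Num.sg (a1 - a0); pose sb := Num.sg (b1 - b0).
pose H t := l * ease t + - sa * (eased a0 a1 t)^-1 + - sb * (eased b0 b1 t)^-1.
pose h t := l * ease' t + `|a1 - a0| * ease' t / eased a0 a1 t ^+ 2
  + `|b1 - b0| * ease' t / eased b0 b1 t ^+ 2.
have dH (t : R) : 0 <= t <= 1 -> is_derive t 1 H (h t).
  move=> _.
  have A := is_derive_inv (f := eased a0 a1) (neq0 _ (a_ge1 t)) (is_derive_eased a0 a1 t).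
  have B := is_derive_inv (f := eased b0 b1) (neq0 _ (b_ge1 t)) (is_derive_eased b0 b1 t).
  have Z (s : R) (f : R -> R) (d : R) :
      is_derive t 1 f d -> is_derive t 1 (fun x => s * f x : R) (s * d).
    move=> fd; have H1 := is_derive_mul (is_derive_cst (s : R) t (1 : R)) fd.
    by apply: (is_derive_eq H1); rewrite mulr0 addr0.
  have E := is_derive_add (is_derive_add (Z l _ _ (is_derive_ease t))
    (Z (- sa) _ _ A)) (Z (- sb) _ _ B).
  apply: (is_derive_eq E).
  rewrite /h [`|a1 - a0|]normrEsg [`|b1 - b0|]normrEsg -/sa -/sb.
  by field; rewrite !neq0.
apply: (le_trans (curve_length_le cs dH _)) => [t t01|].
  rewrite sE; have e0 := ease'_ge0 t01.
  apply: le_trans (sqrt_sum_le _ _) _; first by rewrite addr_ge0 ?sqr_ge0.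
  rewrite /h -addrA; apply: lerD.
    rewrite (exprMn _ (a1 - a0)) (exprMn _ (b1 - b0)) -mulrDl.
    by rewrite sqrtrM ?addr_ge0 ?sqr_ge0 // sqrtr_sqr (ger0_norm e0).
  move: (a_ge1 t) (b_ge1 t); set a := eased a0 a1 t; set b := eased b0 b1 t.
  move=> a1' b1'.
  have -> : - (a * b) ^- 2 * (a * ((b1 - b0) * ease' t) + b * ((a1 - a0) * ease' t))
     = - ((a1 - a0) * ease' t / a ^+ 2 * b^-1 + (b1 - b0) * ease' t / b ^+ 2 * a^-1).
    by field; rewrite !neq0.
  rewrite normrN (le_trans (ler_normD _ _)) //.
  have inv_le (x : R) : 1 <= x -> `|x^-1| <= 1.
    move=> x1; have x0 : 0 < x by rewrite (lt_le_trans ltr01).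
    by rewrite ger0_norm ?invr_ge0 ?(ltW x0) // invf_le1.
  have sq_norm (x : R) : `|x ^- 2| = x ^- 2.
    by rewrite ger0_norm // invr_ge0 sqr_ge0.
  have termE (d x y : R) : 1 <= y ->
      `|d * ease' t / x ^+ 2 * y^-1| <= `|d| * ease' t / x ^+ 2.
    move: (ease' t) e0 => e e0 y1.
    rewrite !normrM sq_norm (ger0_norm e0) ler_piMr ?inv_le //.
    by rewrite !mulr_ge0 // invr_ge0 sqr_ge0.
  by rewrite lerD // termE.
have E1 : ease 1 = 1 :> R by rewrite /ease; field.
have E0 : ease 0 = 0 :> R by rewrite /ease !mulr0 mul0r mulr0.
rewrite /H !eased0 !eased1 E1 E0.
have sg_bound (s x y : R) : 1 <= x -> 1 <= y -> Num.sg s * (x^-1 - y^-1) <= 1.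
  move=> x1 y1; rewrite (le_trans (ler_norm _)) // normrM normr_sg.
  have x0 : 0 < x by rewrite (lt_le_trans ltr01).
  have y0 : 0 < y by rewrite (lt_le_trans ltr01).
  rewrite mulr_ile1 // ?lern1 ?leq_b1 // ler_norml.
  have xi : 0 <= x^-1 <= 1 by rewrite invr_ge0 (ltW x0) invf_le1.
  have yi : 0 <= y^-1 <= 1 by rewrite invr_ge0 (ltW y0) invf_le1.
  by move: xi yi => /andP[? ?] /andP[? ?]; lra.
have := sg_bound (a1 - a0) _ _ a01 a11; have := sg_bound (b1 - b0) _ _ b01 b11.
by rewrite -/sa -/sb; lra.
Qed.

(** For positive a and b, the point (a, b, 1/(ab)) of the surface. *)
Definition tz_pt (R : realType) (a b : R) : 'rV[R]_2 :=
  \row_j if j == 0 then ln a else ln b.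

Lemma cx_tz_pt (R : realType) (a b : R) : 0 < a -> cx (tz_pt a b) = a.
Proof. by move=> a0; rewrite /cx mxE lnK // posrE. Qed.

Lemma cy_tz_pt (R : realType) (a b : R) : 0 < b -> cy (tz_pt a b) = b.
Proof. by move=> b0; rewrite /cy mxE lnK // posrE. Qed.

Lemma czE (R : realType) (p : 'rV[R]_2) : cz p = (cx p * cy p)^-1.
Proof. by rewrite /cz expRN expRD. Qed.

Lemma cz_tz_pt (R : realType) (a b : R) : 0 < a -> 0 < b ->
  cz (tz_pt a b) = (a * b)^-1.
Proof. by move=> a0 b0; rewrite czE cx_tz_pt // cy_tz_pt. Qed.

Lemma tz_pt_smooth_curve (R : realType) (A B : R -> R) :
  (forall t, 0 < A t) -> (forall t, 0 < B t) ->
  (forall k, Ck_on k setT A) -> (forall k, Ck_on k setT B) ->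
  smooth_curve (fun t => tz_pt (A t) (B t) : tzitzeica R).
Proof.
move=> A0 B0 Ak Bk; apply/tz_smooth_curveP => k; apply: Ck_mx => i j.
case: (ord2E j) => ->.
  rewrite (_ : (fun x => _) = fun t => ln (A t)); first exact: Ck_ln.
  by apply/funext => t; rewrite mxE.
rewrite (_ : (fun x => _) = fun t => ln (B t)); first exact: Ck_ln.
by apply/funext => t; rewrite mxE.
Qed.

(** The second and third claims concern the other two faces: their points are (a, 1/(ab), b) and
    (1/(ab), a, b). *)
Lemma tz_reach_face (R : realType) (a0 b0 a1 b1 : R) :
  1 <= a0 -> 1 <= b0 -> 1 <= a1 -> 1 <= b1 ->
  let r := Num.sqrt ((a1 - a0) ^+ 2 + (b1 - b0) ^+ 2) + 2 in
  [/\ @reach R (tzitzeica R) (tz_pt a0 b0) (tz_pt a1 b1) r,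
      @reach R (tzitzeica R) (tz_pt a0 (a0 * b0)^-1) (tz_pt a1 (a1 * b1)^-1) r &
      @reach R (tzitzeica R) (tz_pt (a0 * b0)^-1 a0) (tz_pt (a1 * b1)^-1 a1) r].
Proof.
move=> a01 b01 a11 b11 r.
pose A := eased a0 a1; pose B := eased b0 b1; pose G t := (A t * B t)^-1.
have A0 t : 0 < A t by rewrite (lt_le_trans ltr01) // eased_ge.
have B0 t : 0 < B t by rewrite (lt_le_trans ltr01) // eased_ge.
have AB0 t : 0 < A t * B t by rewrite mulr_gt0.
have G0 t : 0 < G t by rewrite invr_gt0.
have Ak k : Ck_on k setT A by exact: Ck_eased.
have Bk k : Ck_on k setT B by exact: Ck_eased.
have Gk k : Ck_on k setT G by apply: Ck_inv => //; exact: Ck_mul.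
have dA t := is_derive_eased a0 a1 t; have dB t := is_derive_eased b0 b1 t.
have dG t := is_derive_inv (f := fun t => A t * B t) (lt0r_neq0 (AB0 t))
  (is_derive_mul (dA t) (dB t)).
have A_0 : A 0 = a0 by exact: eased0.
have A_1 : A 1 = a1 by exact: eased1.
have B_0 : B 0 = b0 by exact: eased0.
have B_1 : B 1 = b1 by exact: eased1.
have GA t : (A t * G t)^-1 = B t.
  by rewrite /G invfM invrK mulrA mulVf ?mul1r // lt0r_neq0.
have GA' t : (G t * A t)^-1 = B t by rewrite mulrC GA.
split.
- pose c t : tzitzeica R := tz_pt (A t) (B t).
  have cs : smooth_curve c by exact: tz_pt_smooth_curve.
  have := reach_curve cs (face_curve_length cs a01 a11 b01 b11 _).
  rewrite /c A_0 A_1 B_0 B_1; apply => t; rewrite -/A -/B.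
  have xE : @cx R \o c = A by apply/funext => s; exact: cx_tz_pt.
  have yE : @cy R \o c = B by apply/funext => s; exact: cy_tz_pt.
  have zE : @cz R \o c = G by apply/funext => s; exact: cz_tz_pt.
  by apply: (tz_speed_derive cs); rewrite ?xE ?yE ?zE.
- pose c t : tzitzeica R := tz_pt (A t) (G t).
  have cs : smooth_curve c by exact: tz_pt_smooth_curve.
  have := reach_curve cs (face_curve_length cs a01 a11 b01 b11 _).
  rewrite /c /G A_0 A_1 B_0 B_1; apply => t; rewrite -/A -/B.
  have xE : @cx R \o c = A by apply/funext => s; exact: cx_tz_pt.
  have yE : @cy R \o c = G by apply/funext => s; exact: cy_tz_pt.
  have zE : @cz R \o c = B by apply/funext => s; rewrite /= cz_tz_pt.
  by rewrite addrAC; apply: (tz_speed_derive cs); rewrite ?xE ?yE ?zE.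
- pose c t : tzitzeica R := tz_pt (G t) (A t).
  have cs : smooth_curve c by exact: tz_pt_smooth_curve.
  have := reach_curve cs (face_curve_length cs a01 a11 b01 b11 _).
  rewrite /c /G A_0 A_1 B_0 B_1; apply => t; rewrite -/A -/B.
  have xE : @cx R \o c = G by apply/funext => s; exact: cx_tz_pt.
  have yE : @cy R \o c = A by apply/funext => s; exact: cy_tz_pt.
  have zE : @cz R \o c = B by apply/funext => s; rewrite /= cz_tz_pt.
  by rewrite addrC addrA; apply: (tz_speed_derive cs); rewrite ?xE ?yE ?zE.
Qed.

(** * The Riemannian distance and functions on the corner *)

Lemma riem_dist_le (R : realType) (p q : tzitzeica R) r :
  reach p q r -> riem_dist p q <= r.
Proof.
move=> [L pq Lr]; apply: le_trans Lr; apply: ge_inf => //.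
exists 0 => l pql.
(* A constant test function shows that lengths are nonnegative, so the infimum is taken over a set
   bounded below. *)
have := @path_length_ge R (fun=> 0) p q l _ pql; rewrite subr0; apply.
by move=> x; near=> y; rewrite normr0 sqrtr_ge0.
Unshelve. all: by end_near. Qed.

Lemma riem_dist_ge (R : realType) (F : 'rV[R]_2 -> R) (p q : tzitzeica R) :
  (forall p, \forall q \near p, `|F q - F p| <= tz_chord p q) ->
  F p - F q <= riem_dist p q.
Proof.
move=> FL; apply: lb_le_inf; last by move=> L; exact: path_length_ge.
(* The infimum is taken over an inhabited set. *)
by have [L pq _] := tz_reach_taxicab p q; exists L.
Qed.

Lemma cauchy_schwarz2 (R : realType) (a b x y : R) : a ^+ 2 + b ^+ 2 <= 1 ->
  `|a * x + b * y| <= Num.sqrt (x ^+ 2 + y ^+ 2).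
Proof.
move=> ab1; rewrite -sqrtr_sqr ler_wsqrtr //.
have := sqr_ge0 (a * y - b * x).
have : (a ^+ 2 + b ^+ 2) * (x ^+ 2 + y ^+ 2) <= 1 * (x ^+ 2 + y ^+ 2).
  by rewrite ler_wpM2r // addr_ge0 ?sqr_ge0.
rewrite !sqrrD !exprMn sqrrN; lra.
Qed.

Lemma ler_dist_min (R : realType) (a b c d r : R) :
  `|a - c| <= r -> `|b - d| <= r -> `|Num.min a b - Num.min c d| <= r.
Proof.
rewrite !ler_norml => /andP[? ?] /andP[? ?].
by rewrite !minEle; case: (leP a b) => ?; case: (leP c d) => ?; apply/andP; split; lra.
Qed.

Lemma ler_dist_max0 (R : realType) (m a b : R) :
  `|Num.max (a - m) 0 - Num.max (b - m) 0| <= `|a - b|.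
Proof.
have := ler_norm (a - b); have := ler_norm (b - a); rewrite (distrC b).
rewrite !maxEle ler_norml.
by case: (leP (a - m) 0) => ?; case: (leP (b - m) 0) => ? ? ?; apply/andP; split; lra.
Qed.

(** Only pairs on a common face are compared, which is enough for a local bound. *)
Definition corner_lipschitz (R : realType) (f : R -> R -> R -> R) :=
  forall a b a' b', 0 <= a -> 0 <= b -> 0 <= a' -> 0 <= b' ->
  let r := Num.sqrt ((a - a') ^+ 2 + (b - b') ^+ 2) in
  [/\ `|f a b 0 - f a' b' 0| <= r, `|f a 0 b - f a' 0 b'| <= r &
      `|f 0 a b - f 0 a' b'| <= r].

(* The surface never meets [x, y, z >= 2], so it projects onto the corner with
   vertex (2, 2, 2), translated here to the origin. *)
Definition corner_map (R : realType) (f : R -> R -> R -> R) (p : 'rV[R]_2) : R :=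
  f (Num.max (cx p - 2) 0) (Num.max (cy p - 2) 0) (Num.max (cz p - 2) 0).

Lemma tz_coord_gt0 (R : realType) (p : 'rV[R]_2) :
  [/\ 0 < cx p, 0 < cy p & 0 < cz p].
Proof. by rewrite !expR_gt0. Qed.

Lemma tz_coord_lt2 (R : realType) (p : 'rV[R]_2) :
  [\/ cx p < 2, cy p < 2 | cz p < 2].
Proof.
have [x0 y0 z0] := tz_coord_gt0 p.
have [?|x2] := ltP (cx p) 2; first by constructor 1.
have [?|y2] := ltP (cy p) 2; first by constructor 2.
constructor 3; rewrite czE invf_plt ?posrE ?mulr_gt0 //.
have : 2 * 2 <= cx p * cy p by rewrite ler_pM.
by lra.
Qed.

Lemma continuous_cx (R : realType) : continuous (@cx R).
Proof.
by move=> p; apply: continuous_comp; [exact: coord_continuous|exact: continuous_expR].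
Qed.

Lemma continuous_cy (R : realType) : continuous (@cy R).
Proof.
by move=> p; apply: continuous_comp; [exact: coord_continuous|exact: continuous_expR].
Qed.

Lemma continuous_cz (R : realType) : continuous (@cz R).
Proof.
move=> p; apply: continuous_comp; last exact: continuous_expR.
exact: cvgN (cvgD (@coord_continuous R 1 2 0 0 p) (@coord_continuous R 1 2 0 1 p)).
Qed.

(** Some coordinate of p is below 2 and stays so nearby, hence p and its neighbours project to the
    same face; truncating the other two coordinates does not increase distances. *)
Lemma corner_map_chord (R : realType) (f : R -> R -> R -> R) :
  corner_lipschitz f ->
  forall p, \forall q \near p,
    `|corner_map f q - corner_map f p| <= tz_chord p q.
Proof.
move=> fL p.
have near2 (g : 'rV[R]_2 -> R) : continuous g -> g p < 2 ->
    \forall q \near p, Num.max (g q - 2) 0 = 0.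
  move=> gc gp; near=> q; rewrite max_r // subr_le0 ltW //.
  by near: q; exact: cvgr_lt (g p) (gc p) 2 gp.
have self2 (g : 'rV[R]_2 -> R) : g p < 2 -> Num.max (g p - 2) 0 = 0.
  by move=> gp; rewrite max_r // subr_le0 ltW.
have pos (x : R) : 0 <= Num.max (x - 2) 0 by rewrite le_max lexx orbT.
have sq (x y : R) : (Num.max (x - 2) 0 - Num.max (y - 2) 0) ^+ 2 <= (x - y) ^+ 2.
  rewrite -(real_normK (num_real (_ - Num.max _ _))) -(real_normK (num_real (x - y))).
  by rewrite ler_sqr ?nnegrE // ler_dist_max0.
rewrite /corner_map /tz_chord; case: (tz_coord_lt2 p) => h.
- near=> q; rewrite (self2 _ h); have -> : Num.max (cx q - 2) 0 = 0.
    by near: q; exact: near2 (@continuous_cx R) h.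
  have [_ _ fq] := fL _ _ _ _ (pos (cy q)) (pos (cz q)) (pos (cy p)) (pos (cz p)).
  apply: le_trans fq _; rewrite ler_wsqrtr // -[leLHS]add0r -addrA.
  by rewrite lerD ?sqr_ge0 // lerD.
- near=> q; rewrite (self2 _ h); have -> : Num.max (cy q - 2) 0 = 0.
    by near: q; exact: near2 (@continuous_cy R) h.
  have [_ fq _] := fL _ _ _ _ (pos (cx q)) (pos (cz q)) (pos (cx p)) (pos (cz p)).
  apply: le_trans fq _; rewrite ler_wsqrtr // -[leLHS]addr0 [leRHS]addrAC.
  by rewrite lerD ?sqr_ge0 // lerD.
- near=> q; rewrite (self2 _ h); have -> : Num.max (cz q - 2) 0 = 0.
    by near: q; exact: near2 (@continuous_cz R) h.
  have [fq _ _] := fL _ _ _ _ (pos (cx q)) (pos (cy q)) (pos (cx p)) (pos (cy p)).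
  apply: le_trans fq _; rewrite ler_wsqrtr // -[leLHS]addr0.
  by rewrite lerD ?sqr_ge0 // lerD.
Unshelve. all: by end_near. Qed.

Lemma corner_lipschitz_swap (R : realType) (f : R -> R -> R -> R) :
  corner_lipschitz f -> corner_lipschitz (fun x y z => f y x z).
Proof.
move=> fL a b a' b' a0 b0 a'0 b'0 r.
have [_ f2 f3] := fL a b a' b' a0 b0 a'0 b'0.
have [f1 _ _] := fL b a b' a' b0 a0 b'0 a'0.
have rE : r = Num.sqrt ((b - b') ^+ 2 + (a - a') ^+ 2) by rewrite /r addrC.
by split; [rewrite rE; exact: f1|exact: f3|exact: f2].
Qed.

(* The arc length along the line a-p-c-x, which has slope 7/24 in the
   development of the faces.  The second term of the minimum only serves to
   close up around the vertex: the line itself stays where the first one is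
   active. *)
Definition corner_line (R : realType) (x y z : R) : R :=
  - (24/25 * x) + Num.min (24/25 * y + 7/25 * z) (24/25 * z - 7/25 * y).

Lemma corner_line_lipschitz (R : realType) : corner_lipschitz (@corner_line R).
Proof.
move=> a b a' b' a0 b0 a'0 b'0 r; rewrite /corner_line.
have lin (s t d d' : R) : s ^+ 2 + t ^+ 2 <= 1 ->
    d - d' = s * (a - a') + t * (b - b') -> `|d - d'| <= r.
  by move=> st ->; exact: cauchy_schwarz2.
split.
- rewrite !mulr0 !addr0 !add0r !min_r; try lra.
  by apply: (lin (- (24/25)) (- (7/25))); lra.
- rewrite !mulr0 !add0r !subr0 !min_l; try lra.
  by apply: (lin (- (24/25)) (7/25)); lra.
- rewrite !mulr0 !oppr0 !add0r; apply: ler_dist_min.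
    by apply: (lin (24/25) (7/25)); lra.
  by apply: (lin (- (7/25)) (24/25)); lra.
Qed.

(* Separates x from y on the two faces through the z-axis and vanishes on the
   third one, where p and q lie. *)
Definition corner_gap (R : realType) (x y z : R) : R :=
  Num.min y z - Num.min x z.

Lemma corner_gap_lipschitz (R : realType) : corner_lipschitz (@corner_gap R).
Proof.
move=> a b a' b' a0 b0 a'0 b'0 r; rewrite /corner_gap.
have ar : `|a - a'| <= r by rewrite -sqrtr_sqr ler_wsqrtr // lerDl sqr_ge0.
have br : `|b - b'| <= r by rewrite -sqrtr_sqr ler_wsqrtr // lerDr sqr_ge0.
split.
- by rewrite !min_r // !subrr normr0 sqrtr_ge0.
- rewrite (min_l b0) (min_l b'0) !sub0r -opprD normrN.
  exact: ler_dist_min.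
- by rewrite (min_l b0) (min_l b'0) !subr0; exact: ler_dist_min.
Qed.

Lemma riem_dist_ge_corner (R : realType) (f : R -> R -> R -> R)
    (p q : tzitzeica R) : corner_lipschitz f ->
  corner_map f p - corner_map f q <= riem_dist p q.
Proof. by move=> fL; apply: riem_dist_ge; exact: corner_map_chord. Qed.

Lemma riem_dist_ge_coord (R : realType) (p q : tzitzeica R) :
  [/\ `|cx p - cx q| <= riem_dist p q, `|cy p - cy q| <= riem_dist p q &
      `|cz p - cz q| <= riem_dist p q].
Proof.
have gen (g : 'rV[R]_2 -> R) : (forall p q, `|g q - g p| <= tz_chord p q) ->
    `|g p - g q| <= riem_dist p q.
  move=> gL; rewrite ler_norml lerNl opprB; apply/andP; split.
    rewrite (_ : g q - g p = (- g p) - (- g q)); last by rewrite opprK addrC.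
    apply: (@riem_dist_ge R (fun x => - g x)) => x; near=> y.
    by rewrite opprK addrC distrC gL.
  by apply: riem_dist_ge => x; near=> y; exact: gL.
by split; apply: gen => x y; rewrite -sqrtr_sqr ler_wsqrtr //;
  [rewrite -addrA lerDl|rewrite addrAC lerDr|rewrite lerDr];
  rewrite addr_ge0 ?sqr_ge0.
Unshelve. all: by end_near. Qed.

(** The test function is the coordinate along the horizontal direction from q to p. *)
Lemma riem_dist_ge_xy (R : realType) (p q : tzitzeica R) :
  (cx p - cx q) ^+ 2 + (cy p - cy q) ^+ 2 <= riem_dist p q ^+ 2.
Proof.
set s := _ + _.
have s0 : 0 <= s by rewrite addr_ge0 ?sqr_ge0.
have [xd _ _] := riem_dist_ge_coord p q.
have d0 : 0 <= riem_dist p q := le_trans (normr_ge0 _) xd.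
have [sE|sn] := eqVneq s 0; first by rewrite sE sqr_ge0.
have n0 : 0 < Num.sqrt s by rewrite sqrtr_gt0 lt_neqAle eq_sym sn.
suff : Num.sqrt s <= riem_dist p q.
  by move=> h; rewrite -[leLHS]sqr_sqrtr // ler_sqr ?nnegrE // sqrtr_ge0.
pose a := (cx p - cx q) / Num.sqrt s; pose b := (cy p - cy q) / Num.sqrt s.
have ab1 : a ^+ 2 + b ^+ 2 <= 1.
  by rewrite /a /b !exprMn -mulrDl exprVn sqr_sqrtr // divff.
have -> : Num.sqrt s = (a * cx p + b * cy p) - (a * cx q + b * cy q).
  have -> : (a * cx p + b * cy p) - (a * cx q + b * cy q) =
     ((cx p - cx q) ^+ 2 + (cy p - cy q) ^+ 2) / Num.sqrt s.
    by rewrite /a /b; field; rewrite gt_eqF.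
  by rewrite -/s -{2}(sqr_sqrtr s0) expr2 mulfK // gt_eqF.
apply: (@riem_dist_ge R (fun r => a * cx r + b * cy r)) => x; near=> y.
have -> : (a * cx y + b * cy y) - (a * cx x + b * cy x) =
  a * (cx y - cx x) + b * (cy y - cy x) by ring.
apply: le_trans (cauchy_schwarz2 _ _ ab1) _.
by rewrite ler_wsqrtr // lerDl sqr_ge0.
Unshelve. all: by end_near. Qed.

(** * Completeness of the surface *)

Lemma tz_complete (R : realType) : complete_dist (@riem_dist R (tzitzeica R)).
Proof.
move=> u u_cauchy.
have coord_cvg (g : 'rV[R]_2 -> R) :
    (forall p q : tzitzeica R, `|g p - g q| <= riem_dist p q) ->
    cvgn (fun n => g (u n)).
  move=> gL; apply: cauchy_cvg; apply: cauchy_exP => e e0.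
  have [N uN] := u_cauchy e e0.
  exists (g (u N)); exists N => // n /= Nn; rewrite -ball_normE.
  exact: le_lt_trans (gL _ _) (uN _ _ (leqnn N) Nn).
have /coord_cvg ux : forall p q : tzitzeica R, `|cx p - cx q| <= riem_dist p q.
  by move=> p q; have [] := riem_dist_ge_coord p q.
have /coord_cvg uy : forall p q : tzitzeica R, `|cy p - cy q| <= riem_dist p q.
  by move=> p q; have [] := riem_dist_ge_coord p q.
have /coord_cvg uz : forall p q : tzitzeica R, `|cz p - cz q| <= riem_dist p q.
  by move=> p q; have [] := riem_dist_ge_coord p q.
set x := limn _ in ux; set y := limn _ in uy; set z := limn _ in uz.
have xyz : x * y * z = 1.
  have : (fun n => cx (u n) * cy (u n) * cz (u n)) @ \oo --> x * y * z.
    exact: cvgM (cvgM ux uy) uz.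
  rewrite (_ : (fun n => _) = fun=> 1); last first.
    apply/funext => n; have [x0 y0 _] := tz_coord_gt0 (u n).
    by rewrite czE mulfV // lt0r_neq0 // mulr_gt0.
  by move/cvg_lim => <- //; rewrite lim_cst.
have nonneg (g : 'rV[R]_2 -> R) : (forall p, 0 < g p) ->
    cvgn (fun n => g (u n)) -> 0 <= limn (fun n => g (u n)).
  by move=> g0 gc; apply: limr_ge => //; near=> n; exact: ltW.
have x0 : 0 <= x by exact: (nonneg (@cx R) (fun p => expR_gt0 _) ux).
have y0 : 0 <= y by exact: (nonneg (@cy R) (fun p => expR_gt0 _) uy).
(* Limits of positive coordinates could vanish; the closed condition xyz = 1 excludes this, so the
   limit lies on the surface. *)
have : x * y * z != 0 by rewrite xyz oner_eq0.
rewrite !mulf_eq0 !negb_or => /andP[/andP[xn yn] zn].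
have {x0}xn : 0 < x by rewrite lt_neqAle eq_sym xn.
have {y0}yn : 0 < y by rewrite lt_neqAle eq_sym yn.
have zE : z = (x * y)^-1.
  apply: (mulfI (lt0r_neq0 (mulr_gt0 xn yn))).
  by rewrite xyz mulfV // lt0r_neq0 ?mulr_gt0.
exists (tz_pt x y).
apply: (squeeze_cvgr (f := fun=> 0)
  (h := fun n => `|x - cx (u n)| + `|y - cy (u n)| + `|z - cz (u n)|)).
- near=> n; apply/andP; split.
    by have [h _ _] := riem_dist_ge_coord (u n) (tz_pt x y); exact: le_trans h.
  have := riem_dist_le (tz_reach_taxicab (u n) (tz_pt x y)).
  by rewrite cx_tz_pt // cy_tz_pt // cz_tz_pt // -zE.
- exact: cvg_cst.
- have dist0 (v : nat -> R) (l : R) : v n @[n --> \oo] --> l ->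
      `|l - v n| @[n --> \oo] --> (0 : R).
    move=> vl; rewrite -[X in _ --> X](@normr0 R R) -(subrr l).
    by apply: cvg_norm; apply: cvgB => //; exact: cvg_cst.
  rewrite -[X in _ --> X](addr0 (0 : R)) -[X in _ --> X + _](addr0 (0 : R)).
  exact: cvgD (cvgD (dist0 _ _ ux) (dist0 _ _ uy)) (dist0 _ _ uz).
Unshelve. all: by end_near. Qed.

(** * Distances in the configuration *)

Lemma sqrt_le_sqr (R : realType) (s r : R) : 0 <= r -> s <= r ^+ 2 -> Num.sqrt s <= r.
Proof. by move=> r0 sr; rewrite -(ger0_norm r0) -sqrtr_sqr ler_wsqrtr. Qed.

(** Bridges between adjacent faces: two across the z-axis, in both directions, then one across the
    x-axis and one across the y-axis. The factors 1 match the endpoints in [tz_reach_face_le]. *)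
Lemma tz_reach_edge (R : realType) (m : R) : 1 <= m ->
  [/\ @reach R (tzitzeica R) (tz_pt (1 * m)^-1 1) (tz_pt 1 (1 * m)^-1) 2,
      @reach R (tzitzeica R) (tz_pt 1 (1 * m)^-1) (tz_pt (1 * m)^-1 1) 2,
      @reach R (tzitzeica R) (tz_pt m (m * 1)^-1) (tz_pt m 1) 2 &
      @reach R (tzitzeica R) (tz_pt (m * 1)^-1 m) (tz_pt 1 m) 2].
Proof.
move=> m1; have m0 : 0 < m by exact: lt_le_trans ltr01 m1.
have mi0 : 0 < m^-1 by rewrite invr_gt0.
have mi1 : m^-1 <= 1 by rewrite invf_le1.
have n1 : `|1 - m^-1| <= 1 by rewrite ger0_norm ?subr_ge0 // gerBl ltW.
have n2 : `|m^-1 - 1| <= 1 by rewrite distrC.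
have le2 (p q : tzitzeica R) : `|cx q - cx p| + `|cy q - cy p| + `|cz q - cz p| <= 2 ->
    reach p q 2.
  move=> pq; have [L pL Lr] := tz_reach_taxicab p q.
  by exists L => //; exact: le_trans pq.
by rewrite !mulr1 !mul1r; split; apply: le2;
  rewrite !cz_tz_pt // !cx_tz_pt // !cy_tz_pt // ?mulr1 ?mul1r ?invrK
    ?mulVf ?mulfV ?invr1 ?lt0r_neq0 ?subrr ?normr0; lra.
Qed.

Lemma tz_reach_face_le (R : realType) (a0 b0 a1 b1 r : R) :
  1 <= a0 -> 1 <= b0 -> 1 <= a1 -> 1 <= b1 -> 0 <= r ->
  (a1 - a0) ^+ 2 + (b1 - b0) ^+ 2 <= r ^+ 2 ->
  [/\ @reach R (tzitzeica R) (tz_pt a0 b0) (tz_pt a1 b1) (r + 2),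
      @reach R (tzitzeica R) (tz_pt a0 (a0 * b0)^-1) (tz_pt a1 (a1 * b1)^-1) (r + 2) &
      @reach R (tzitzeica R) (tz_pt (a0 * b0)^-1 a0) (tz_pt (a1 * b1)^-1 a1) (r + 2)].
Proof.
move=> ? ? ? ? r0 hr; have [] := @tz_reach_face R a0 b0 a1 b1 => //.
have mono (p q : tzitzeica R) s s' : s <= s' -> reach p q s -> reach p q s'.
  by move=> ss' [L ? ?]; exists L => //; exact: le_trans ss'.
have hs : Num.sqrt ((a1 - a0) ^+ 2 + (b1 - b0) ^+ 2) + 2 <= r + 2.
  by rewrite lerD2r sqrt_le_sqr.
by move=> h1 h2 h3; split; exact: mono hs _.
Qed.

(* The path follows the straight line in the development, crossing the edges
   next to (0, 0, 112 l) and (384 l, 0, 0), resp. (0, 384 l, 0). *)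
Lemma tz_long_arms (R : realType) (l : R) : 1 <= l ->
  @reach R (tzitzeica R) (tz_pt (72 * l * (133 * l))^-1 (72 * l))
     (tz_pt (888 * l) (147 * l)) (1000 * l + 10) /\
  @reach R (tzitzeica R) (tz_pt (72 * l) (72 * l * (133 * l))^-1)
     (tz_pt (147 * l) (888 * l)) (1000 * l + 10).
Proof.
move=> l1.
have h72 : 1 <= 72 * l by lra.
have h112 : 1 <= 112 * l by lra.
have h133 : 1 <= 133 * l by lra.
have h147 : 1 <= 147 * l by lra.
have h384 : 1 <= 384 * l by lra.
have h888 : 1 <= 888 * l by lra.
(* The three pieces are hypotenuses of 3, 16 and 21 times the triangle 7, 24, 25, of total length
   1000. Three faces and two bridges cost 2 each, which gives the 10. *)
have r75 : 0 <= 75 * l by lra.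
have r400 : 0 <= 400 * l by lra.
have r525 : 0 <= 525 * l by lra.
have [z1 z2 _ _] := tz_reach_edge h112.
have [_ _ x1 y1] := tz_reach_edge h384.
have s1 : (1 - 72 * l) ^+ 2 + (112 * l - 133 * l) ^+ 2 <= (75 * l) ^+ 2.
  have := sqr_ge0 l; nra.
have s2 : (384 * l - 1) ^+ 2 + (1 - 112 * l) ^+ 2 <= (400 * l) ^+ 2.
  have := sqr_ge0 l; nra.
have s3 : (888 * l - 384 * l) ^+ 2 + (147 * l - 1) ^+ 2 <= (525 * l) ^+ 2.
  have := sqr_ge0 l; nra.
have s3' : (147 * l - 1) ^+ 2 + (888 * l - 384 * l) ^+ 2 <= (525 * l) ^+ 2.
  by rewrite addrC.
have [_ Y1 X1] := tz_reach_face_le h72 h133 (lexx 1) h112 r75 s1.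
have [_ Y2 X2] := tz_reach_face_le (lexx 1) h112 h384 (lexx 1) r400 s2.
have [Z3 _ _] := tz_reach_face_le h384 (lexx 1) h888 h147 r525 s3.
have [Z3' _ _] := tz_reach_face_le (lexx 1) h384 h147 h888 r525 s3'.
have -> : 1000 * l + 10 = (75 * l + 2) + (2 + ((400 * l + 2) + (2 + (525 * l + 2)))).
  by ring.
split.
  exact: reach_trans X1 (reach_trans z1 (reach_trans Y2 (reach_trans x1 Z3))).
exact: reach_trans Y1 (reach_trans z2 (reach_trans X2 (reach_trans y1 Z3'))).
Qed.

Lemma ge1M (R : realType) (l k : R) : 1 <= l -> 1 <= k -> 1 <= k * l.
Proof. by move=> l1 k1; rewrite -[leLHS]mulr1 ler_pM. Qed.

Lemma tz_dist_face_le (R : realType) (l s t s' t' r : R) :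
  1 <= l -> 1 <= s -> 1 <= t -> 1 <= s' -> 1 <= t' -> 0 <= r ->
  (s' - s) ^+ 2 + (t' - t) ^+ 2 <= r ^+ 2 ->
  @riem_dist R (tzitzeica R) (tz_pt (s * l) (t * l)) (tz_pt (s' * l) (t' * l))
    <= r * l + 2.
Proof.
move=> l1 s1 t1 s1' t1' r0 h; apply: riem_dist_le.
have l0 : 0 <= l by exact: le_trans ler01 l1.
have [] // := @tz_reach_face_le R (s * l) (t * l) (s' * l) (t' * l) (r * l)
  (ge1M l1 s1) (ge1M l1 t1) (ge1M l1 s1') (ge1M l1 t1') (mulr_ge0 r0 l0).
by rewrite -!mulrBl !exprMn -mulrDl ler_wpM2r ?sqr_ge0.
Qed.

Lemma tz_dist_face_ge (R : realType) (l s t s' t' m : R) :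
  1 <= l -> 1 <= s -> 1 <= t -> 1 <= s' -> 1 <= t' ->
  (s - s') ^+ 2 + (t - t') ^+ 2 = m ->
  m * l ^+ 2 <= @riem_dist R (tzitzeica R) (tz_pt (s * l) (t * l))
    (tz_pt (s' * l) (t' * l)) ^+ 2.
Proof.
move=> l1 s1 t1 s1' t1' <-; apply: le_trans (riem_dist_ge_xy _ _).
have pos k : 1 <= k -> 0 < k * l by move=> /(ge1M l1); exact: lt_le_trans.
by rewrite !cx_tz_pt ?pos // !cy_tz_pt ?pos // -!mulrBl !exprMn -mulrDl.
Qed.

(** Up to the shift by 2, [corner_line] is 2659 l / 25 at x and -34841 l / 25 at a; the shift costs
    124/25 < 5. [corner_gap] is 72 l - 2 at x and its opposite at y. *)
Lemma tz_arm_ends (R : realType) (l : R) : 1 <= l ->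
  let x : tzitzeica R := tz_pt (72 * l * (133 * l))^-1 (72 * l) in
  let y : tzitzeica R := tz_pt (72 * l) (72 * l * (133 * l))^-1 in
  [/\ 1500 * l - 5 <= riem_dist x (tz_pt (1368 * l) (287 * l)),
      1500 * l - 5 <= riem_dist y (tz_pt (287 * l) (1368 * l)) &
      144 * l - 4 <= riem_dist x y].
Proof.
move=> l1 x y; have l0 : 0 < l := lt_le_trans ltr01 l1.
have far k : 2 <= k -> Num.max (k * l - 2) 0 = k * l - 2.
  move=> k2; apply/max_idPl; rewrite subr_ge0 -[leLHS]mulr1.
  by rewrite ler_pM.
have small (v : R) : 1 <= v -> Num.max (v^-1 - 2) 0 = 0.
  move=> v1; apply/max_idPr.
  have : v^-1 <= 1 by rewrite invf_le1 // (lt_le_trans ltr01).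
  by clear; lra.
have pos k : 2 <= k -> 0 < k * l.
  by move=> k2; rewrite mulr_gt0 ?(lt_le_trans _ k2) // (lt_le_trans ltr01).
have k72 : 2 <= 72 :> R by clear; lra.
have k133 : 2 <= 133 :> R by clear; lra.
have k287 : 2 <= 287 :> R by clear; lra.
have k1368 : 2 <= 1368 :> R by clear; lra.
have prod s t : 2 <= s -> 2 <= t -> 1 <= s * l * (t * l).
  move=> s2 t2; rewrite -[leLHS]mulr1 ler_pM // ge1M //.
    by rewrite (le_trans _ s2) // ler1n.
  by rewrite (le_trans _ t2) // ler1n.
have nearE f s t : 2 <= s -> 2 <= t ->
    corner_map f (tz_pt (s * l) (t * l)) = f (s * l - 2) (t * l - 2) 0.
  move=> s2 t2; rewrite /corner_map cx_tz_pt ?pos // cy_tz_pt ?pos //.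
  by rewrite cz_tz_pt ?pos // !far // small ?prod.
have p72 := pos _ k72; have p133 := pos _ k133.
have pV : 0 < (72 * l * (133 * l))^-1 by rewrite invr_gt0 mulr_gt0.
have cancel : (72 * l * (72 * l * (133 * l))^-1)^-1 = 133 * l.
  by field; rewrite lt0r_neq0.
have xE f : corner_map f x = f 0 (72 * l - 2) (133 * l - 2).
  rewrite /corner_map cx_tz_pt // cy_tz_pt // cz_tz_pt //.
  by rewrite [_^-1 * _]mulrC cancel small ?prod // !far.
have yE f : corner_map f y = f (72 * l - 2) 0 (133 * l - 2).
  rewrite /corner_map cx_tz_pt // cy_tz_pt // cz_tz_pt //.
  by rewrite cancel small ?prod // !far.
split.
- apply: le_trans (riem_dist_ge_corner x _ (@corner_line_lipschitz R)).
  rewrite xE nearE // /corner_line; move: l1; clear => l1.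
  by rewrite min_l ?min_r; lra.
- apply: le_trans (riem_dist_ge_corner y _
    (corner_lipschitz_swap (@corner_line_lipschitz R))).
  rewrite yE nearE // /corner_line; move: l1; clear => l1.
  by rewrite min_l ?min_r; lra.
- apply: le_trans (riem_dist_ge_corner x y (@corner_gap_lipschitz R)).
  rewrite xE yE /corner_gap; move: l1; clear => l1.
  by rewrite !min_l; lra.
Qed.

Lemma sqr_le_sqr (R : realType) (u v : R) : 0 <= u -> u <= v -> u ^+ 2 <= v ^+ 2.
Proof. by move=> u0 uv; rewrite ler_sqr ?nnegrE // (le_trans u0). Qed.

(** Coefficients of l^2 decide: 144^2 = 20736 on the left; on the right 2 * (61 sqrt 2)^2 = 14884,
    about 1265 for rounding pq up and 217 for the terms in 1/m. The linear terms are dominated by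
    those of weight m, about 1.3 * 10^10 l, hence by 13 l^2. *)
Lemma double_star_numbers (R : realType)
    (l pq ap bq cp dq xp yq aq bp cq ad ca db xa yb xy : R) :
  1 <= l -> 1000 * 1000 * 1000 * l <= l * l ->
  pq <= ((1047 + 95/100) * l + 2) ^+ 2 ->
  ap <= (500 * l + 2) ^+ 2 -> bq <= (500 * l + 2) ^+ 2 ->
  cp <= (500 * l + 2) ^+ 2 -> dq <= (500 * l + 2) ^+ 2 ->
  xp <= (1000 * l + 10) ^+ 2 -> yq <= (1000 * l + 10) ^+ 2 ->
  (1221 ^+ 2 + 601 ^+ 2) * l ^+ 2 <= aq ->
  (1221 ^+ 2 + 601 ^+ 2) * l ^+ 2 <= bp ->
  (261 ^+ 2 + 881 ^+ 2) * l ^+ 2 <= cq ->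
  (1361 ^+ 2 + 121 ^+ 2) * l ^+ 2 <= ad ->
  1000 ^+ 2 * l ^+ 2 <= ca -> 1000 ^+ 2 * l ^+ 2 <= db ->
  (1500 * l - 5) ^+ 2 <= xa -> (1500 * l - 5) ^+ 2 <= yb ->
  (144 * l - 4) ^+ 2 <= xy ->
  ~ xy <= 2 * (17 * pq + 14 * ap + 14 * bq - 2 * aq - 6 * bp
      - 4 * (1 - (100 * 1000)^-1) * (cq + ad)
      + 4 * (100 * 1000 - 1) * (2 * cp + 2 * ap - ca)
      + 4 * (100 * 1000 - 1) * (2 * dq + 2 * bq - db))
    + 4 * (3 * xp + 6 * ap - 2 * xa) + 4 * (3 * yq + 6 * bq - 2 * yb).
Proof.
move=> l1 l_large.
pose s := l * l.
have sE k m : (k * l + m) ^+ 2 = k * k * s + 2 * m * k * l + m * m by rewrite /s; ring.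
have lE : l ^+ 2 = s by rewrite /s expr2.
rewrite !sE !lE; move: l_large; rewrite -/s; clear sE lE; clearbody s.
lra.
Qed.

(** * Failure of the bipolar comparison *)

Lemma tz_not_bipolar (R : realType) :
  ~ bipolar_comparison 3 3 (@riem_dist R (tzitzeica R)).
Proof.
move=> bip.
have [l [l1 l_large]] : exists l : R, 1 <= l /\ 1000 * 1000 * 1000 * l <= l * l.
  by exists (1000 * 1000 * 1000); split; clear; lra.
(* In units of [25 l], the line a-p-c-x starts at a, meets p after 20, c after
   40, x after 60, and runs through the x-axis and the z-axis in between. *)
pose x : tzitzeica R := tz_pt (72 * l * (133 * l))^-1 (72 * l).
pose y : tzitzeica R := tz_pt (72 * l) (72 * l * (133 * l))^-1.
pose pt a b : tzitzeica R := tz_pt (a * l) (b * l).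
pose p := pt 888 147; pose a := pt 1368 287; pose c := pt 408 7.
pose q := pt 147 888; pose b := pt 287 1368; pose d := pt 7 408.
have d_ge0 u v : 0 <= @riem_dist R (tzitzeica R) u v.
  by have [h _ _] := riem_dist_ge_coord u v; exact: le_trans h.
have xp : riem_dist x p ^+ 2 <= (1000 * l + 10) ^+ 2.
  apply: sqr_le_sqr (d_ge0 _ _) _; apply: riem_dist_le.
  by have [] := tz_long_arms l1.
have yq : riem_dist y q ^+ 2 <= (1000 * l + 10) ^+ 2.
  apply: sqr_le_sqr (d_ge0 _ _) _; apply: riem_dist_le.
  by have [] := tz_long_arms l1.
have pq : riem_dist p q ^+ 2 <= ((1047 + 95/100) * l + 2) ^+ 2.
  apply: sqr_le_sqr (d_ge0 _ _) _.
  by apply: tz_dist_face_le l1 _ _ _ _ _ _; clear; lra.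
have ap : riem_dist a p ^+ 2 <= (500 * l + 2) ^+ 2.
  apply: sqr_le_sqr (d_ge0 _ _) _.
  by apply: tz_dist_face_le l1 _ _ _ _ _ _; clear; lra.
have cp : riem_dist c p ^+ 2 <= (500 * l + 2) ^+ 2.
  apply: sqr_le_sqr (d_ge0 _ _) _.
  by apply: tz_dist_face_le l1 _ _ _ _ _ _; clear; lra.
have bq : riem_dist b q ^+ 2 <= (500 * l + 2) ^+ 2.
  apply: sqr_le_sqr (d_ge0 _ _) _.
  by apply: tz_dist_face_le l1 _ _ _ _ _ _; clear; lra.
have dq : riem_dist d q ^+ 2 <= (500 * l + 2) ^+ 2.
  apply: sqr_le_sqr (d_ge0 _ _) _.
  by apply: tz_dist_face_le l1 _ _ _ _ _ _; clear; lra.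
have aq : (1221 ^+ 2 + 601 ^+ 2) * l ^+ 2 <= riem_dist a q ^+ 2.
  by apply: tz_dist_face_ge l1 _ _ _ _ _; clear; lra.
have bp : (1221 ^+ 2 + 601 ^+ 2) * l ^+ 2 <= riem_dist b p ^+ 2.
  by apply: tz_dist_face_ge l1 _ _ _ _ _; clear; lra.
have cq : (261 ^+ 2 + 881 ^+ 2) * l ^+ 2 <= riem_dist c q ^+ 2.
  by apply: tz_dist_face_ge l1 _ _ _ _ _; clear; lra.
have ad : (1361 ^+ 2 + 121 ^+ 2) * l ^+ 2 <= riem_dist a d ^+ 2.
  by apply: tz_dist_face_ge l1 _ _ _ _ _; clear; lra.
have ca : 1000 ^+ 2 * l ^+ 2 <= riem_dist c a ^+ 2.
  by apply: tz_dist_face_ge l1 _ _ _ _ _; clear; lra.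
have db : 1000 ^+ 2 * l ^+ 2 <= riem_dist d b ^+ 2.
  by apply: tz_dist_face_ge l1 _ _ _ _ _; clear; lra.
have [xa yb xy] := tz_arm_ends l1.
have {}xa : (1500 * l - 5) ^+ 2 <= riem_dist x a ^+ 2.
  by apply: sqr_le_sqr xa; move: l1; clear; lra.
have {}yb : (1500 * l - 5) ^+ 2 <= riem_dist y b ^+ 2.
  by apply: sqr_le_sqr yb; move: l1; clear; lra.
have {}xy : (144 * l - 4) ^+ 2 <= riem_dist x y ^+ 2.
  by apply: sqr_le_sqr xy; move: l1; clear; lra.
pose A (i : 'I_4) := nth p [:: p; x; a; c] i.
pose B (i : 'I_4) := nth q [:: q; y; b; d] i.
have [A' [B' /= [h0 hA hB hge]]] := bip A B.
pose o i : 'I_4 := inord i.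
have oE i : (i < 4)%N -> o i = i :> nat by move=> i4; rewrite inordK.
have on0 i : (0 < i < 4)%N -> o i != ord0.
  by move=> /andP[i0 i4]; rewrite -val_eqE /= oE // -lt0n.
(* A large weight m keeps the loss in 1/m small but multiplies the additive errors of the lengths,
   so l is taken much larger still. *)
have m1 : 1 <= 100 * 1000 :> R by clear; lra.
move: {bip} (hilbert_double_star (A' ord0) (A' (o 1%N)) (A' (o 2%N)) (A' (o 3%N))
  (B' ord0) (B' (o 1%N)) (B' (o 2%N)) (B' (o 3%N)) m1).
have A0 : A ord0 = p by [].
have A1 : A (o 1%N) = x by rewrite /A oE.
have A2 : A (o 2%N) = a by rewrite /A oE.
have A3 : A (o 3%N) = c by rewrite /A oE.
have B0 : B ord0 = q by [].
have B1 : B (o 1%N) = y by rewrite /B oE.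
have B2 : B (o 2%N) = b by rewrite /B oE.
have B3 : B (o 3%N) = d by rewrite /B oE.
(* The nine pairs of negative weight need only lower bounds; the seven edges of the tree carry the
   positive weights and keep their lengths. *)
have hge2 s t v : v <= riem_dist (match s with inl i => A i | inr j => B j end)
      (match t with inl i => A i | inr j => B j end) ^+ 2 ->
    v <= hilbert_dist (match s with inl i => A' i | inr j => B' j end)
      (match t with inl i => A' i | inr j => B' j end) ^+ 2.
  by move/le_trans; apply; apply: sqr_le_sqr (d_ge0 _ _) (hge s t).
have {}xy := hge2 (inl (o 1%N)) (inr (o 1%N)) _ (ltac:(rewrite /= A1 B1; exact: xy)).
have {}aq := hge2 (inl (o 2%N)) (inr ord0) _ (ltac:(rewrite /= A2 B0; exact: aq)).
have {}bp := hge2 (inr (o 2%N)) (inl ord0) _ (ltac:(rewrite /= A0 B2; exact: bp)).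
have {}cq := hge2 (inl (o 3%N)) (inr ord0) _ (ltac:(rewrite /= A3 B0; exact: cq)).
have {}ad := hge2 (inl (o 2%N)) (inr (o 3%N)) _ (ltac:(rewrite /= A2 B3; exact: ad)).
have {}ca := hge2 (inl (o 3%N)) (inl (o 2%N)) _ (ltac:(rewrite /= A3 A2; exact: ca)).
have {}db := hge2 (inr (o 3%N)) (inr (o 2%N)) _ (ltac:(rewrite /= B3 B2; exact: db)).
have {}xa := hge2 (inl (o 1%N)) (inl (o 2%N)) _ (ltac:(rewrite /= A1 A2; exact: xa)).
have {}yb := hge2 (inr (o 1%N)) (inr (o 2%N)) _ (ltac:(rewrite /= B1 B2; exact: yb)).
rewrite A0 B0 in h0.
have h1 := hA _ (on0 1%N isT); rewrite A0 A1 in h1.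
have h2 := hA _ (on0 2%N isT); rewrite A0 A2 in h2.
have h3 := hA _ (on0 3%N isT); rewrite A0 A3 in h3.
have k1 := hB _ (on0 1%N isT); rewrite B0 B1 in k1.
have k2 := hB _ (on0 2%N isT); rewrite B0 B2 in k2.
have k3 := hB _ (on0 3%N isT); rewrite B0 B3 in k3.
rewrite -h0 in pq; rewrite -h1 in xp; rewrite -h2 in ap; rewrite -h3 in cp.
rewrite -k1 in yq; rewrite -k2 in bq; rewrite -k3 in dq.
move: l1 l_large pq ap bq cp dq xp yq aq bp cq ad ca db xa yb xy.
exact: double_star_numbers.
Qed.

Theorem corollary1p3 (R : realType) : @riem_bipolar R 3 3 <> @riem_sec_ge0 R.
Proof.
move=> E; have [_] : riem_bipolar 3 3 (tzitzeica R).
  rewrite E; split; first exact: tz_complete.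
  by move=> i x _ u v _; exact: tz_sectional_curvature_ge0.
exact: tz_not_bipolar.
Qed.
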